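(* Let $E=\{\zeta_j\}_{j=1}^n$ and $F=\{\xi_k\}_{k=1}^m$ be two disjoint finite sets of distinct points on the unit circle $\mathbb{T}=\{|z|=1\}$. Let $f$ be analytic on the unit disk $\mathbb{D}=\{|z|<1\}$ with $|f(0)|=1$, and suppose that for some constant $K>0$ and exponents $p,q,r\ge 0$, $$\log|f(z)|\le\frac{K}{(1-|z|)^p}\,\frac{\operatorname{dist}^r(z,E)}{\operatorname{dist}^q(z,F)}, \qquad z\in\mathbb{D}.$$ Then for every $\varepsilon>0$ there is a positive number $C_2=C_2(E,F,p,q,r,\varepsilon)$ such that $$\sum_{\zeta\in Z(f)} (1-|\zeta|)^{p+1+\varepsilon}\,\frac{\operatorname{dist}^{(q-1+\varepsilon)_+}(\zeta,F)}{\operatorname{dist}^{\min(p,r)}(\zeta,E)}\le C_2\cdot K.$$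
   Context: $Z(f)$ denotes the zero set of $f$ in $\mathbb{D}$, counted with multiplicities. $\operatorname{dist}(z,B)$ is the Euclidean distance from $z$ to the set $B$. $a_+:=\max(a,0)$. *)

(* Defs.v *)
From Stdlib Require Import Reals List.
From Coquelicot Require Import Coquelicot.
Open Scope R_scope.

Definition C_differentiable (f : C -> C) (z : C) : Prop :=
  @ex_derive C_AbsRing C_NormedModule f z.

Definition in_disk (z : C) : Prop := Cmod z < 1.

Definition analytic_on_disk (f : C -> C) : Prop :=
  forall z, in_disk z -> C_differentiable f z.

Definition zero_mult (f : C -> C) (a : C) (m : nat) : Prop :=
  exists (g : C -> C) (rho : R), 0 < rho /\
    (forall z, Cmod (z - a) < rho -> C_differentiable g z) /\
    g a <> 0%C /\
    (forall z, Cmod (z - a) < rho -> f z = Cmult (pow_n (z - a)%C m) (g z)).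

Definition dist_set (z : C) (l : list C) : R :=
  match l with
  | nil => 0
  | w :: l' => fold_left (fun acc v => Rmin acc (Cmod (z - v))) l' (Cmod (z - w))
  end.

Definition pos_part (a : R) : R := Rmax a 0.

Definition rpow (x a : R) : R := Rpower x a.

Definition zero_weight (E F : list C) (p q r eps : R) (zeta : C) : R :=
  rpow (1 - Cmod zeta) (p + 1 + eps)
  * rpow (dist_set zeta F) (pos_part (q - 1 + eps))
  / rpow (dist_set zeta E) (Rmin p r).

(* Sum over Z(f) counted with multiplicity, bounded by B: every finite
   family of distinct zeros in D, each weighted by its multiplicity,
   has weighted sum at most B (the sum of nonnegative terms is the
   supremum of its finite partial sums). *)
Definition zero_sum_le (f : C -> C) (w : C -> R) (B : R) : Prop :=
  forall (l : list (C * nat)),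
    NoDup (map fst l) ->
    (forall am, In am l -> in_disk (fst am) /\ f (fst am) = 0%C
                           /\ zero_mult f (fst am) (snd am)) ->
    fold_right (fun am acc => INR (snd am) * w (fst am) + acc) 0 l <= B.

(* Main.v *)
(* Put k = min(p,r)/(p+eps) < 1, let d(z) = 1-|z|, and exhaust the disk by the domains
   Omega(c,s) = { d(z) > c dist(z,E)^k, dist(z,F) > s }. On the boundary of Omega(c,s) the
   hypothesis gives log|f| <= C K c^-p s^-(q-q') dist(z,F)^-q' with some q' < 1, and this
   is dominated by the real part of an explicit sum of powers (1 - conj xi z)^-q', xi in F,
   whose value at 0 is O(K c^-p s^-(q-q')). The Green function of Omega(c,s) at 0
   is bounded from below explicitly: for a zero zeta with d(zeta) >= A c dist(zeta,E)^k and dist(zeta,F) >= A s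
   one corrects log(1/|b_zeta|), b_zeta the Blaschke factor, by d(zeta) times a small
   multiple of the real part of 1/(w + d(zeta)^(1-k) w^k) + sum over xi in F of
   1/(1 - conj xi z), w = 1 - conj zeta z, which makes it nonpositive on the boundary while
   keeping at least half of d(zeta) at 0. The maximum principle for f divided by all these
   factors then bounds the sum of d(zeta) over such zeros by C K c^-p s^-(q-q').
   Summing over dyadic c and s gives the theorem, as d^(p+1+eps)/dist(.,E)^min(p,r) equals
   d u^(p+eps) with u = d/dist(.,E)^k <= dist(.,F)^(1-k). *)

Require Import Defs.
From Stdlib Require Import Reals List.
From Coquelicot Require Import Coquelicot.
From Stdlib Require Import Lra Psatz Classical ClassicalEpsilon.
Open Scope R_scope.

(** * Complex differentiability *)

(** The exponent k serves three ends: k p <= r keeps the leftover factor dist(z,E)^(r - k p) bounded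
    on the boundary, k (p + eps) = min(p,r) turns the weight into a power of u, and k < 1 keeps
    cos(k pi / 2), the constant in the lower bound for the real part of a k-th power, positive. For
    this last reason q' stays below 1 as well. The delicate point on the boundary is a constant.
    Since Re w >= 1 - |z|, a numerical multiple of d(zeta) Re(1/w) already dominates log(1/|b_zeta|)
    there, but its value at 0 is too large to leave anything of d(zeta). The selected zeros,
    however, lie deeper than the boundary by the factor A, and the term d(zeta)^(1-k) w^k turns this
    depth into a real part exceeding (1 - |z|)/|w|^2 by a multiple of A. A large A therefore permits
    a small coefficient. The loss eps is spent in halves: one half makes the sum over c converge,
    the other is traded for a power of dist(.,F) that makes the sum over s converge. *)

Definition Ccont (f : C -> C) (z : C) : Prop :=
  forall eps, 0 < eps -> exists d, 0 < d /\
    forall w, Cmod (w - z) < d -> Cmod (f w - f z) < eps.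

(* Caratheodory's form of complex differentiability: the difference quotient
   extends to a function that is continuous at [z]. *)
Definition Cdiff (f : C -> C) (z : C) : Prop :=
  exists phi, Ccont phi z /\
    forall w, f w = (f z + phi w * (w - z))%C.

Lemma Cmod_sub_sym (a b : C) : Cmod (a - b) = Cmod (b - a).
Proof. replace (a - b)%C with (- (b - a))%C by ring. apply Cmod_opp. Qed.

Lemma Cmod_sub_0 (a : C) : Cmod (a - a) = 0.
Proof. replace (a - a)%C with (RtoC 0) by ring. apply Cmod_0. Qed.

Lemma Cmod_triangle_rev (a b : C) : Cmod a - Cmod b <= Cmod (a - b).
Proof.
  pose proof (Cmod_triangle (a - b) b) as H.
  replace (a - b + b)%C with a in H by ring. lra.
Qed.

Lemma Cmod_sub_triangle (a b c : C) : Cmod (a - c) <= Cmod (a - b) + Cmod (b - c).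
Proof.
  replace (a - c)%C with ((a - b) + (b - c))%C by ring. apply Cmod_triangle.
Qed.

Lemma Cmod_sub_neq (a b : C) : a <> b -> 0 < Cmod (a - b).
Proof.
  intro H. apply Cmod_gt_0. intro H0. apply H.
  replace a with ((a - b) + b)%C by ring. rewrite H0. ring.
Qed.

Lemma Ccont_const (c z : C) : Ccont (fun _ => c) z.
Proof.
  intros eps He. exists 1. split; [lra|]. intros. rewrite Cmod_sub_0. exact He.
Qed.

Lemma Ccont_id (z : C) : Ccont (fun w => w) z.
Proof. intros eps He. exists eps. split; auto. Qed.

Lemma Ccont_plus (f g : C -> C) (z : C) :
  Ccont f z -> Ccont g z -> Ccont (fun w => f w + g w)%C z.
Proof.
  intros Hf Hg eps He.
  destruct (Hf (eps / 2)) as [d1 [Hd1 H1]]; [lra|].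
  destruct (Hg (eps / 2)) as [d2 [Hd2 H2]]; [lra|].
  exists (Rmin d1 d2). split; [apply Rmin_pos; auto|]. intros w Hw.
  pose proof (Rmin_l d1 d2). pose proof (Rmin_r d1 d2).
  specialize (H1 w ltac:(lra)). specialize (H2 w ltac:(lra)).
  replace (f w + g w - (f z + g z))%C with ((f w - f z) + (g w - g z))%C by ring.
  pose proof (Cmod_triangle (f w - f z) (g w - g z)). lra.
Qed.

Lemma Ccont_mult (f g : C -> C) (z : C) :
  Ccont f z -> Ccont g z -> Ccont (fun w => f w * g w)%C z.
Proof.
  intros Hf Hg eps He.
  pose proof (Cmod_ge_0 (f z)) as Pf. pose proof (Cmod_ge_0 (g z)) as Pg.
  set (M := Cmod (f z) + Cmod (g z) + 1).
  assert (HM : 0 < M) by (unfold M; lra).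
  set (e := Rmin 1 (eps / (2 * M))).
  assert (He' : 0 < e).
  { apply Rmin_pos; [lra|]. apply Rdiv_lt_0_compat; lra. }
  destruct (Hf e He') as [d1 [Hd1 H1]].
  destruct (Hg e He') as [d2 [Hd2 H2]].
  exists (Rmin d1 d2). split; [apply Rmin_pos; auto|]. intros w Hw.
  pose proof (Rmin_l d1 d2). pose proof (Rmin_r d1 d2).
  specialize (H1 w ltac:(lra)). specialize (H2 w ltac:(lra)).
  assert (e1 : e <= 1) by apply Rmin_l.
  assert (e2 : e * M <= eps / 2).
  { replace (eps / 2) with (eps / (2 * M) * M) by (field; lra).
    apply Rmult_le_compat_r; [lra|]. apply Rmin_r. }
  replace (f w * g w - f z * g z)%C with
    ((f w - f z) * (g w - g z) + (f w - f z) * g z + f z * (g w - g z))%C by ring.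
  eapply Rle_lt_trans; [apply Cmod_triangle|].
  eapply Rle_lt_trans; [apply Rplus_le_compat_r; apply Cmod_triangle|].
  rewrite !Cmod_mult.
  pose proof (Cmod_ge_0 (f w - f z)). pose proof (Cmod_ge_0 (g w - g z)).
  assert (Cmod (f w - f z) * Cmod (g w - g z) <= e * 1) by (apply Rmult_le_compat; lra).
  assert (Cmod (f w - f z) * Cmod (g z) <= e * Cmod (g z)) by (apply Rmult_le_compat_r; lra).
  assert (Cmod (f z) * Cmod (g w - g z) <= Cmod (f z) * e) by (apply Rmult_le_compat_l; lra).
  unfold M in e2. nra.
Qed.

Lemma Ccont_comp (f g : C -> C) (z : C) :
  Ccont f z -> Ccont g (f z) -> Ccont (fun w => g (f w)) z.
Proof.
  intros Hf Hg eps He. destruct (Hg eps He) as [d [Hd H]].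
  destruct (Hf d Hd) as [d' [Hd' H']]. exists d'. split; auto.
Qed.

Lemma Ccont_inv (z : C) : z <> 0%C -> Ccont Cinv z.
Proof.
  intros Hz eps He. apply Cmod_gt_0 in Hz as Hz'.
  set (m := Cmod z) in *.
  exists (Rmin (m / 2) (eps * (m * m / 2))). split.
  { apply Rmin_pos; [lra|]. apply Rmult_lt_0_compat; [lra|nra]. }
  intros w Hw.
  pose proof (Rmin_l (m / 2) (eps * (m * m / 2))).
  pose proof (Rmin_r (m / 2) (eps * (m * m / 2))).
  assert (Hwm : m / 2 < Cmod w).
  { pose proof (Cmod_triangle_rev z w). rewrite Cmod_sub_sym in Hw. fold m in H1. lra. }
  assert (Hw0 : w <> 0%C) by (apply Cmod_gt_0; lra).
  replace (/ w - / z)%C with ((z - w) * / (w * z))%C by (field; auto).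
  rewrite Cmod_mult, Cmod_inv, Cmod_mult by (apply Cmult_neq_0; auto).
  fold m. rewrite Cmod_sub_sym.
  apply Rlt_div_l; [nra|].
  assert (eps * (m / 2 * m) < eps * (Cmod w * m)) by (apply Rmult_lt_compat_l; nra).
  lra.
Qed.

Lemma Cdiff_cont (f : C -> C) (z : C) : Cdiff f z -> Ccont f z.
Proof.
  intros [phi [Hp Hf]] eps He.
  assert (K : Ccont (fun w => f z + phi w * (w - z))%C z).
  { apply Ccont_plus; [apply Ccont_const|]. apply Ccont_mult; [exact Hp|].
    apply (Ccont_plus (fun w => w) (fun _ => - z)%C); [apply Ccont_id|apply Ccont_const]. }
  destruct (K eps He) as [d [Hd H]]. exists d. split; [exact Hd|].
  intros w Hw. specialize (H w Hw). simpl in H. rewrite <- !Hf in H. exact H.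
Qed.

(** The quotient is completed by l at z, excluded middle deciding whether w = z. Keeping track of
    [phi z = l] matters for the logarithm, where the quotient of the exponential must be known to be
    nonzero. *)
Lemma Caratheodory_of_eps (f : C -> C) (z l : C) :
  (forall eps, 0 < eps -> exists d, 0 < d /\ forall w, Cmod (w - z) < d ->
     Cmod (f w - f z - l * (w - z)) <= eps * Cmod (w - z)) ->
  exists phi, Ccont phi z /\ phi z = l /\
    forall w, f w = (f z + phi w * (w - z))%C.
Proof.
  intro H.
  exists (fun w => if excluded_middle_informative (w = z) then l
                   else ((f w - f z) / (w - z))%C).
  split; [|split].
  - intros eps He. destruct (H (eps / 2)) as [d [Hd Hw]]; [lra|].
    exists d. split; [exact Hd|]. intros w Hwd.
    destruct (excluded_middle_informative (z = z)) as [_|n]; [|congruence].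
    destruct (excluded_middle_informative (w = z)) as [->|n].
    { rewrite Cmod_sub_0. exact He. }
    specialize (Hw w Hwd). apply Cmod_sub_neq in n as n'.
    assert (n0 : (w - z)%C <> 0%C) by (apply Cmod_gt_0; exact n').
    replace ((f w - f z) / (w - z) - l)%C
      with ((f w - f z - l * (w - z)) * / (w - z))%C by (field; exact n0).
    rewrite Cmod_mult, Cmod_inv by exact n0.
    apply Rlt_div_l; [exact n'|]. nra.
  - destruct (excluded_middle_informative (z = z)) as [_|n]; [reflexivity|congruence].
  - intro w. destruct (excluded_middle_informative (w = z)) as [->|n].
    + ring.
    + field. apply Cmod_gt_0. apply Cmod_sub_neq. exact n.
Qed.

Lemma Cdiff_of_eps (f : C -> C) (z l : C) :
  (forall eps, 0 < eps -> exists d, 0 < d /\ forall w, Cmod (w - z) < d ->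
     Cmod (f w - f z - l * (w - z)) <= eps * Cmod (w - z)) ->
  Cdiff f z.
Proof.
  intro H. destruct (Caratheodory_of_eps f z l H) as [phi [Hp [_ Hf]]].
  exists phi. auto.
Qed.

Lemma Cdiff_eps (f : C -> C) (z : C) : Cdiff f z ->
  exists l, forall eps, 0 < eps -> exists d, 0 < d /\ forall w, Cmod (w - z) < d ->
     Cmod (f w - f z - l * (w - z)) <= eps * Cmod (w - z).
Proof.
  intros [phi [Hp Hf]]. exists (phi z). intros eps He.
  destruct (Hp eps He) as [d [Hd H]]. exists d. split; [exact Hd|].
  intros w Hw. rewrite (Hf w).
  replace (f z + phi w * (w - z) - f z - phi z * (w - z))%C
    with ((phi w - phi z) * (w - z))%C by ring.
  rewrite Cmod_mult. apply Rmult_le_compat_r; [apply Cmod_ge_0|].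
  left. apply H. exact Hw.
Qed.

(** Caratheodory's identity is required for all w, so a change of the function far from z also
    changes [phi]. The detour through the epsilon form makes the notion local again. *)
Lemma Cdiff_ext_loc (f g : C -> C) (z : C) (d : R) :
  0 < d -> (forall w, Cmod (w - z) < d -> f w = g w) -> Cdiff f z -> Cdiff g z.
Proof.
  intros Hd He Hf. destruct (Cdiff_eps f z Hf) as [l Hl].
  apply (Cdiff_of_eps g z l). intros eps Hp.
  destruct (Hl eps Hp) as [d' [Hd' H]]. exists (Rmin d d').
  split; [apply Rmin_pos; auto|]. intros w Hw.
  pose proof (Rmin_l d d'). pose proof (Rmin_r d d').
  rewrite <- (He w), <- (He z) by (rewrite ?Cmod_sub_0; lra).
  apply H. lra.
Qed.

Lemma C_differentiable_Cdiff (f : C -> C) (z : C) : C_differentiable f z -> Cdiff f z.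
Proof.
  intros [l [_ Hl]].
  apply (Cdiff_of_eps f z l). intros eps He.
  (* The neighbourhood filter of z converges to z trivially. Its balls in [C_AbsRing] are the disks
     for [Cmod], so the estimate can be read off directly. *)
  specialize (Hl z (fun P H => H) (mkposreal eps He)).
  destruct Hl as [d Hd]. exists d. split; [apply cond_pos|].
  intros w Hw. specialize (Hd w Hw).
  change (Cmod (minus (minus (f w) (f z)) (scal (minus w z) l)) <= eps * Cmod (w - z)) in Hd.
  replace (f w - f z - l * (w - z))%C with (minus (minus (f w) (f z)) (scal (minus w z) l)).
  exact Hd.
  change (((f w - f z) - (w - z) * l)%C = (f w - f z - l * (w - z))%C). ring.
Qed.

Lemma Cdiff_const (c z : C) : Cdiff (fun _ => c) z.
Proof. exists (fun _ => 0%C). split; [apply Ccont_const|]. intro. ring. Qed.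

Lemma Cdiff_id (z : C) : Cdiff (fun w => w) z.
Proof. exists (fun _ => 1%C). split; [apply Ccont_const|]. intro. ring. Qed.

Lemma Cdiff_plus (f g : C -> C) (z : C) :
  Cdiff f z -> Cdiff g z -> Cdiff (fun w => f w + g w)%C z.
Proof.
  intros [p [Hp Ef]] [q [Hq Eg]]. exists (fun w => p w + q w)%C.
  split; [apply Ccont_plus; auto|]. intro w. rewrite (Ef w), (Eg w). ring.
Qed.

Lemma Cdiff_mult (f g : C -> C) (z : C) :
  Cdiff f z -> Cdiff g z -> Cdiff (fun w => f w * g w)%C z.
Proof.
  intros Hf Hg. pose proof (Cdiff_cont g z Hg) as Cg.
  destruct Hf as [p [Hp Ef]]. destruct Hg as [q [Hq Eg]].
  exists (fun w => p w * g w + f z * q w)%C. split.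
  - apply Ccont_plus; apply Ccont_mult; auto using Ccont_const.
  - intro w. rewrite (Ef w), (Eg w). ring.
Qed.

Lemma Cdiff_opp (f : C -> C) (z : C) : Cdiff f z -> Cdiff (fun w => - f w)%C z.
Proof.
  intro H. apply (Cdiff_ext_loc (fun w => (- (1)) * f w)%C _ z 1); [lra| |].
  - intros. ring.
  - apply Cdiff_mult; [apply Cdiff_const|exact H].
Qed.

Lemma Cdiff_minus (f g : C -> C) (z : C) :
  Cdiff f z -> Cdiff g z -> Cdiff (fun w => f w - g w)%C z.
Proof. intros. apply (Cdiff_plus f (fun w => - g w)%C); auto using Cdiff_opp. Qed.

Lemma Cdiff_comp (f g : C -> C) (z : C) :
  Cdiff f z -> Cdiff g (f z) -> Cdiff (fun w => g (f w)) z.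
Proof.
  intros Hf Hg. pose proof (Cdiff_cont f z Hf) as Cf.
  destruct Hf as [p [Hp Ef]]. destruct Hg as [q [Hq Eg]].
  exists (fun w => q (f w) * p w)%C. split.
  - apply Ccont_mult; [apply (Ccont_comp f q); auto|exact Hp].
  - intro w. rewrite (Eg (f w)). rewrite (Ef w) at 2. ring.
Qed.

Lemma Cdiff_pow (f : C -> C) (n : nat) (z : C) : Cdiff f z -> Cdiff (fun w => f w ^ n)%C z.
Proof.
  intro H. induction n as [|n IH].
  - exact (Cdiff_const 1%C z).
  - apply (Cdiff_mult f (fun w => f w ^ n)%C); auto.
Qed.

(* If [g (L w) = w] and [L] is continuous, the Caratheodory quotient of [L] is
   the inverse of that of [g]. *)
Lemma Cdiff_right_inverse (g L : C -> C) (z : C) (d : R) :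
  0 < d -> (forall w, Cmod (w - z) < d -> g (L w) = w) -> Ccont L z ->
  (exists q, Ccont q (L z) /\ q (L z) <> 0%C /\
     forall w, g w = (g (L z) + q w * (w - L z))%C) ->
  Cdiff L z.
Proof.
  intros Hd HL CL [q [Hq [Hq0 Eg]]].
  apply (Cdiff_of_eps L z (/ q (L z))).
  assert (CI : Ccont (fun w => / q (L w))%C z).
  { apply (Ccont_comp (fun w => q (L w)) Cinv).
    - apply (Ccont_comp L q); auto.
    - apply Ccont_inv. exact Hq0. }
  assert (CQ : Ccont (fun w => q (L w)) z) by (apply (Ccont_comp L q); auto).
  destruct (CQ (Cmod (q (L z)))) as [d1 [Hd1 H1]].
  { apply Cmod_gt_0. exact Hq0. }
  intros eps He. destruct (CI eps He) as [d2 [Hd2 H2]].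
  exists (Rmin d (Rmin d1 d2)). split; [repeat apply Rmin_pos; auto|].
  intros w Hw.
  pose proof (Rmin_l d (Rmin d1 d2)). pose proof (Rmin_r d (Rmin d1 d2)).
  pose proof (Rmin_l d1 d2). pose proof (Rmin_r d1 d2).
  specialize (H1 w ltac:(lra)). specialize (H2 w ltac:(lra)). simpl in H1, H2.
  assert (Hqw : q (L w) <> 0%C).
  { intro Z. rewrite Z in H1.
    replace (0 - q (L z))%C with (- q (L z))%C in H1 by ring.
    rewrite Cmod_opp in H1. lra. }
  pose proof (Eg (L w)) as E.
  rewrite (HL w ltac:(lra)), (HL z) in E by (rewrite Cmod_sub_0; exact Hd).
  assert (E2 : (w - z)%C = (q (L w) * (L w - L z))%C) by (rewrite E at 1; ring).
  replace (L w - L z - / q (L z) * (w - z))%C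
    with ((/ q (L w) - / q (L z)) * (w - z))%C by (rewrite E2; field; auto).
  rewrite Cmod_mult. apply Rmult_le_compat_r; [apply Cmod_ge_0|lra].
Qed.

Lemma Cdiff_inv_at (z : C) : z <> 0%C -> Cdiff Cinv z.
Proof.
  intro Hz.
  apply (Cdiff_of_eps Cinv z (- / (z * z))). intros eps He.
  destruct (Ccont_inv z Hz (eps * Cmod z)) as [d [Hd H]].
  { apply Rmult_lt_0_compat; [exact He|]. apply Cmod_gt_0; exact Hz. }
  exists (Rmin d (Cmod z)). split.
  { apply Rmin_pos; [exact Hd|]. apply Cmod_gt_0; exact Hz. }
  intros w Hw.
  pose proof (Rmin_l d (Cmod z)). pose proof (Rmin_r d (Cmod z)).
  assert (Hw0 : w <> 0%C).
  { intros ->. replace (0 - z)%C with (- z)%C in Hw by ring.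
    rewrite Cmod_opp in Hw. lra. }
  specialize (H w ltac:(lra)).
  replace (/ w - / z - - / (z * z) * (w - z))%C
    with (- (/ w - / z) * / z * (w - z))%C by (field; auto).
  rewrite !Cmod_mult, Cmod_opp, Cmod_inv by exact Hz.
  apply Rmult_le_compat_r; [apply Cmod_ge_0|].
  apply Cmod_gt_0 in Hz. apply Rle_div_l; [exact Hz|lra].
Qed.

Lemma Cdiff_inv (f : C -> C) (z : C) : Cdiff f z -> f z <> 0%C -> Cdiff (fun w => / f w)%C z.
Proof. intros Hf H0. apply (Cdiff_comp f Cinv); auto using Cdiff_inv_at. Qed.

Lemma Cdiff_div (f g : C -> C) (z : C) :
  Cdiff f z -> Cdiff g z -> g z <> 0%C -> Cdiff (fun w => f w / g w)%C z.
Proof. intros. apply (Cdiff_mult f (fun w => / g w)%C); auto using Cdiff_inv. Qed.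

(** * Exponential, logarithm and powers on the right half-plane *)

Definition cexp (z : C) : C := (exp (Re z) * cos (Im z), exp (Re z) * sin (Im z)).

(* The principal branch on the right half-plane. *)
Definition clog (z : C) : C := (ln (Cmod z), atan (Im z / Re z)).

Definition cpow (k : R) (z : C) : C := cexp (k * clog z).

Lemma Cmod_sqr (z : C) : Cmod z * Cmod z = Re z * Re z + Im z * Im z.
Proof. pose proof (Cmod2_alt z). nra. Qed.

Lemma Cmod_eq (z : C) (r : R) : 0 <= r -> Re z * Re z + Im z * Im z = r * r -> Cmod z = r.
Proof. intros Hr H. pose proof (Cmod_sqr z). pose proof (Cmod_ge_0 z). nra. Qed.

Lemma im_le_Cmod (z : C) : Rabs (Im z) <= Cmod z.
Proof.
  pose proof (Rmax_Cmod z). pose proof (Rmax_r (Rabs (fst z)) (Rabs (snd z))).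
  unfold Im. lra.
Qed.

Lemma Re_le_Cmod (z : C) : Re z <= Cmod z.
Proof. pose proof (re_le_Cmod z). pose proof (Rle_abs (Re z)). lra. Qed.

Lemma Cmod_le_abs (z : C) : Cmod z <= Rabs (Re z) + Rabs (Im z).
Proof.
  pose proof (Cmod_sqr z). pose proof (Cmod_ge_0 z).
  pose proof (Rabs_pos (Re z)). pose proof (Rabs_pos (Im z)).
  pose proof (Rsqr_abs (Re z)). pose proof (Rsqr_abs (Im z)). unfold Rsqr in *. nra.
Qed.

Lemma Re_plus (a b : C) : Re (a + b) = Re a + Re b.
Proof. reflexivity. Qed.

Lemma Re_minus (a b : C) : Re (a - b) = Re a - Re b.
Proof. reflexivity. Qed.

Lemma Re_scal (k : R) (z : C) : Re (k * z) = k * Re z.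
Proof. unfold Re; simpl. ring. Qed.

Lemma Im_scal (k : R) (z : C) : Im (k * z) = k * Im z.
Proof. unfold Im, Re; simpl. ring. Qed.

Lemma Cmod_cexp (z : C) : Cmod (cexp z) = exp (Re z).
Proof.
  apply Cmod_eq; [left; apply exp_pos|]. unfold cexp; simpl.
  pose proof (sin2_cos2 (Im z)). unfold Rsqr in H.
  replace (exp (Re z) * cos (Im z) * (exp (Re z) * cos (Im z)) +
    exp (Re z) * sin (Im z) * (exp (Re z) * sin (Im z))) with
    (exp (Re z) * exp (Re z) * (sin (Im z) * sin (Im z) + cos (Im z) * cos (Im z))) by ring.
  rewrite H. ring.
Qed.

Lemma cexp_neq_0 (z : C) : cexp z <> 0%C.
Proof. apply Cmod_gt_0. rewrite Cmod_cexp. apply exp_pos. Qed.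

Lemma cexp_plus (a b : C) : cexp (a + b) = (cexp a * cexp b)%C.
Proof.
  unfold cexp. change (Re (a + b)) with (Re a + Re b). change (Im (a + b)) with (Im a + Im b).
  rewrite exp_plus, cos_plus, sin_plus. unfold Cmult; simpl. f_equal; ring.
Qed.

Lemma cexp_0 : cexp 0 = 1%C.
Proof. unfold cexp, RtoC; simpl. rewrite exp_0, cos_0, sin_0. f_equal; ring. Qed.

Lemma derivable_pt_lim_bound (f : R -> R) (x l : R) : derivable_pt_lim f x l ->
  forall eps, 0 < eps -> exists d, 0 < d /\ forall h, Rabs h < d ->
    Rabs (f (x + h) - f x - l * h) <= eps * Rabs h.
Proof.
  intros H eps He. destruct (H eps He) as [d Hd]. exists d.
  split; [apply cond_pos|]. intros h Hh.
  destruct (Req_dec h 0) as [->|n].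
  - rewrite Rplus_0_r. replace (f x - f x - l * 0) with 0 by ring. rewrite Rabs_R0. lra.
  - replace (f (x + h) - f x - l * h) with (((f (x + h) - f x) / h - l) * h) by (field; exact n).
    rewrite Rabs_mult. apply Rmult_le_compat_r; [apply Rabs_pos|]. left. auto.
Qed.

(** With h = x + i y, the real and imaginary parts of e^h - 1 - h are combinations, with bounded
    coefficients, of the first-order remainders of exp at x and of cos and sin at y, plus the
    product x y. *)
Lemma cexp_eps_0 (eps : R) : 0 < eps -> exists d, 0 < d /\ forall h, Cmod h < d ->
  Cmod (cexp h - 1 - h) <= eps * Cmod h.
Proof.
  (* The five error terms below add up to at most 7 e |h|, so a tenth of eps is small enough. *)
  intro He. set (e := Rmin 1 (eps / 10)).
  assert (He' : 0 < e) by (apply Rmin_pos; lra).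
  assert (e1 : e <= 1) by apply Rmin_l. assert (e2 : e <= eps / 10) by apply Rmin_r.
  destruct (derivable_pt_lim_bound _ _ _ (derivable_pt_lim_exp 0) e He') as [d1 [Hd1 H1]].
  destruct (derivable_pt_lim_bound _ _ _ (derivable_pt_lim_cos 0) e He') as [d2 [Hd2 H2]].
  destruct (derivable_pt_lim_bound _ _ _ (derivable_pt_lim_sin 0) e He') as [d3 [Hd3 H3]].
  rewrite exp_0 in H1. rewrite cos_0, sin_0 in H2. rewrite cos_0, sin_0 in H3.
  exists (Rmin (Rmin 1 e) (Rmin d1 (Rmin d2 d3))).
  split; [repeat apply Rmin_pos; lra|].
  intros h Hh.
  pose proof (Rmin_l (Rmin 1 e) (Rmin d1 (Rmin d2 d3))).
  pose proof (Rmin_r (Rmin 1 e) (Rmin d1 (Rmin d2 d3))).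
  pose proof (Rmin_l 1 e). pose proof (Rmin_r 1 e).
  pose proof (Rmin_l d1 (Rmin d2 d3)). pose proof (Rmin_r d1 (Rmin d2 d3)).
  pose proof (Rmin_l d2 d3). pose proof (Rmin_r d2 d3).
  pose proof (re_le_Cmod h) as Hx. pose proof (im_le_Cmod h) as Hy.
  set (x := Re h) in *. set (y := Im h) in *. set (m := Cmod h) in *.
  specialize (H1 x ltac:(lra)). specialize (H2 y ltac:(lra)). specialize (H3 y ltac:(lra)).
  rewrite Rplus_0_l in H1, H2, H3.
  pose proof (Cmod_le_abs (cexp h - 1 - h)) as Hle.
  assert (ER : Re (cexp h - 1 - h) = (exp x - 1 - 1 * x) * cos y + (1 + x) * (cos y - 1 - -0 * y)).
  { unfold cexp, Re, Im; simpl. fold x y. unfold x, y, Re, Im. ring. }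
  assert (EI : Im (cexp h - 1 - h) = (exp x - 1 - 1 * x) * sin y + (1 + x) * (sin y - 0 - 1 * y) + x * y).
  { unfold cexp, Re, Im; simpl. fold x y. unfold x, y, Re, Im. ring. }
  rewrite ER, EI in Hle.
  pose proof (COS_bound y) as Cb. pose proof (SIN_bound y) as Sb.
  assert (Cb' : Rabs (cos y) <= 1) by (apply Rabs_le; lra).
  assert (Sb' : Rabs (sin y) <= 1) by (apply Rabs_le; lra).
  assert (Xb : Rabs (1 + x) <= 2).
  { eapply Rle_trans; [apply Rabs_triang|]. rewrite Rabs_R1. lra. }
  pose proof (Rabs_triang ((exp x - 1 - 1 * x) * cos y) ((1 + x) * (cos y - 1 - -0 * y))) as T1.
  pose proof (Rabs_triang ((exp x - 1 - 1 * x) * sin y + (1 + x) * (sin y - 0 - 1 * y)) (x * y)) as T2.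
  pose proof (Rabs_triang ((exp x - 1 - 1 * x) * sin y) ((1 + x) * (sin y - 0 - 1 * y))) as T3.
  rewrite (Rabs_mult _ (cos y)), (Rabs_mult (1 + x)) in T1.
  rewrite (Rabs_mult x y) in T2.
  rewrite (Rabs_mult _ (sin y)), (Rabs_mult (1 + x)) in T3.
  pose proof (Rabs_pos (exp x - 1 - 1 * x)). pose proof (Rabs_pos (cos y - 1 - -0 * y)).
  pose proof (Rabs_pos (sin y - 0 - 1 * y)). pose proof (Rabs_pos x). pose proof (Rabs_pos y).
  pose proof (Rabs_pos (cos y)). pose proof (Rabs_pos (sin y)). pose proof (Rabs_pos (1 + x)).
  assert (E1 : Rabs (exp x - 1 - 1 * x) <= e * m) by nra.
  assert (E2 : Rabs (cos y - 1 - -0 * y) <= e * m) by nra.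
  assert (E3 : Rabs (sin y - 0 - 1 * y) <= e * m) by nra.
  assert (F1 : Rabs (exp x - 1 - 1 * x) * Rabs (cos y) <= e * m * 1) by (apply Rmult_le_compat; lra).
  assert (F2 : Rabs (exp x - 1 - 1 * x) * Rabs (sin y) <= e * m * 1) by (apply Rmult_le_compat; lra).
  assert (F3 : Rabs (1 + x) * Rabs (cos y - 1 - -0 * y) <= 2 * (e * m)) by (apply Rmult_le_compat; lra).
  assert (F4 : Rabs (1 + x) * Rabs (sin y - 0 - 1 * y) <= 2 * (e * m)) by (apply Rmult_le_compat; lra).
  assert (F5 : Rabs x * Rabs y <= e * m) by (apply Rmult_le_compat; lra).
  assert (m >= 0) by lra.
  assert (10 * (e * m) <= eps * m) by nra.
  assert (0 <= e * m) by nra. lra.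
Qed.

Lemma Caratheodory_cexp (z : C) : exists phi, Ccont phi z /\ phi z = cexp z /\
  forall w, cexp w = (cexp z + phi w * (w - z))%C.
Proof.
  apply (Caratheodory_of_eps cexp z (cexp z)). intros eps He.
  destruct (cexp_eps_0 (eps / exp (Re z))) as [d [Hd H]].
  { apply Rdiv_lt_0_compat; [exact He|apply exp_pos]. }
  exists d. split; [exact Hd|]. intros w Hw. specialize (H _ Hw).
  replace (cexp w) with (cexp (z + (w - z))) by (f_equal; ring). rewrite cexp_plus.
  replace (cexp z * cexp (w - z) - cexp z - cexp z * (w - z))%C
    with (cexp z * (cexp (w - z) - 1 - (w - z)))%C by ring.
  rewrite Cmod_mult, Cmod_cexp. pose proof (exp_pos (Re z)).
  replace (eps * Cmod (w - z)) with (exp (Re z) * (eps / exp (Re z) * Cmod (w - z))) by (field; lra).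
  apply Rmult_le_compat_l; lra.
Qed.

Lemma Cdiff_cexp (z : C) : Cdiff cexp z.
Proof. destruct (Caratheodory_cexp z) as [phi [Hp [_ H]]]. exists phi. auto. Qed.

(** For x > 0 the square root of 1 + (y/x)^2 is |z|/x, hence cos and sin of atan (y/x) are x/|z| and
    y/|z|. *)
Lemma cexp_clog (z : C) : 0 < Re z -> cexp (clog z) = z.
Proof.
  intro Hz. assert (Hm : 0 < Cmod z) by (pose proof (Re_le_Cmod z); lra).
  unfold cexp, clog; simpl. rewrite exp_ln by exact Hm.
  rewrite cos_atan, sin_atan.
  set (x := Re z) in *. set (y := Im z).
  assert (E : sqrt (1 + Rsqr (y / x)) = Cmod z / x).
  { apply sqrt_lem_1.
    - pose proof (Rle_0_sqr (y / x)). lra.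
    - apply Rdiv_le_0_compat; lra.
    - replace (Cmod z / x * (Cmod z / x)) with ((Cmod z * Cmod z) / (x * x)) by (field; lra).
      rewrite Cmod_sqr. fold x y. unfold Rsqr. field. lra. }
  rewrite E.
  transitivity (x, y); [f_equal; field; lra|].
  unfold x, y, Re, Im. destruct z; reflexivity.
Qed.

(** * Continuity of real functions on the plane, and differentiability of the logarithm *)

Definition Rcont (u : C -> R) (z : C) : Prop :=
  forall eps, 0 < eps -> exists d, 0 < d /\
    forall w, Cmod (w - z) < d -> Rabs (u w - u z) < eps.

Lemma Rcont_Ccont (u : C -> R) (z : C) : Rcont u z <-> Ccont (fun w => RtoC (u w)) z.
Proof.
  split; intros H eps He; destruct (H eps He) as [d [Hd H']]; exists d; split; auto;
  intros w Hw; specialize (H' w Hw).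
  - rewrite <- RtoC_minus, Cmod_R. exact H'.
  - rewrite <- RtoC_minus, Cmod_R in H'. exact H'.
Qed.

Lemma Rcont_const (c : R) (z : C) : Rcont (fun _ => c) z.
Proof. apply Rcont_Ccont, Ccont_const. Qed.

Lemma Rcont_plus (u v : C -> R) (z : C) :
  Rcont u z -> Rcont v z -> Rcont (fun w => u w + v w) z.
Proof.
  rewrite !Rcont_Ccont. intros Hu Hv eps He.
  destruct (Ccont_plus _ _ _ Hu Hv eps He) as [d [Hd H]]. exists d. split; [exact Hd|].
  intros w Hw. rewrite !RtoC_plus. auto.
Qed.

Lemma Rcont_mult (u v : C -> R) (z : C) :
  Rcont u z -> Rcont v z -> Rcont (fun w => u w * v w) z.
Proof.
  rewrite !Rcont_Ccont. intros Hu Hv eps He.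
  destruct (Ccont_mult _ _ _ Hu Hv eps He) as [d [Hd H]]. exists d. split; [exact Hd|].
  intros w Hw. rewrite !RtoC_mult. auto.
Qed.

Lemma Rcont_minus (u v : C -> R) (z : C) :
  Rcont u z -> Rcont v z -> Rcont (fun w => u w - v w) z.
Proof.
  intros Hu Hv eps He.
  destruct (Rcont_plus u (fun w => -1 * v w) z Hu (Rcont_mult _ _ _ (Rcont_const (-1) z) Hv) eps He)
    as [d [Hd H]].
  exists d. split; [exact Hd|]. intros w Hw. specialize (H w Hw).
  replace (u w - v w - (u z - v z)) with (u w + -1 * v w - (u z + -1 * v z)) by ring. exact H.
Qed.

Lemma Rcont_comp (u : C -> R) (g : R -> R) (z : C) :
  Rcont u z -> continuity_pt g (u z) -> Rcont (fun w => g (u w)) z.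
Proof.
  intros Hu Hg eps He. destruct (Hg eps He) as [d [Hd H]].
  destruct (Hu d Hd) as [d' [Hd' H']]. exists d'. split; [exact Hd'|].
  intros w Hw. specialize (H' w Hw).
  destruct (Req_dec (u w) (u z)) as [->|n].
  - rewrite Rminus_diag, Rabs_R0. exact He.
  - apply (H (u w)). split; [|exact H']. split; [exact I|auto].
Qed.

Lemma Rcont_lipschitz (u : C -> R) (z : C) :
  (forall w, Rabs (u w - u z) <= Cmod (w - z)) -> Rcont u z.
Proof.
  intros H eps He. exists eps. split; [exact He|]. intros w Hw. specialize (H w). lra.
Qed.

Lemma Rcont_Cmod (z : C) : Rcont Cmod z.
Proof.
  apply Rcont_lipschitz. intro w. apply Rabs_le.
  pose proof (Cmod_triangle_rev w z). pose proof (Cmod_triangle_rev z w).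
  rewrite (Cmod_sub_sym z w) in H0. lra.
Qed.

Lemma Rcont_Re (z : C) : Rcont Re z.
Proof. apply Rcont_lipschitz. intro w. exact (re_le_Cmod (w - z)). Qed.

Lemma Rcont_Im (z : C) : Rcont Im z.
Proof. apply Rcont_lipschitz. intro w. exact (im_le_Cmod (w - z)). Qed.

Lemma Ccont_clog (z : C) : 0 < Re z -> Ccont clog z.
Proof.
  intros Hz eps He.
  assert (Hm : 0 < Cmod z) by (pose proof (Re_le_Cmod z); lra).
  assert (H1 : Rcont (fun w => ln (Cmod w)) z).
  { apply (Rcont_comp Cmod ln); [apply Rcont_Cmod|].
    apply derivable_continuous_pt. exists (/ Cmod z). apply derivable_pt_lim_ln. exact Hm. }
  assert (H2 : Rcont (fun w => atan (Im w * / Re w)) z).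
  { apply (Rcont_comp (fun w => Im w * / Re w) atan).
    - apply Rcont_mult; [apply Rcont_Im|].
      apply (Rcont_comp Re Rinv); [apply Rcont_Re|].
      apply (continuity_pt_inv (fun x => x)); [apply derivable_continuous_pt, derivable_pt_id|lra].
    - apply derivable_continuous_pt, derivable_pt_atan. }
  destruct (H1 (eps / 2)) as [d1 [Hd1 K1]]; [lra|].
  destruct (H2 (eps / 2)) as [d2 [Hd2 K2]]; [lra|].
  exists (Rmin d1 d2). split; [apply Rmin_pos; auto|]. intros w Hw.
  pose proof (Rmin_l d1 d2). pose proof (Rmin_r d1 d2).
  specialize (K1 w ltac:(lra)). specialize (K2 w ltac:(lra)).
  eapply Rle_lt_trans; [apply Cmod_le_abs|].
  change (Rabs (ln (Cmod w) - ln (Cmod z)) + Rabs (atan (Im w / Re w) - atan (Im z / Re z)) < eps).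
  unfold Rdiv. lra.
Qed.

(** The disk of radius Re z about z stays in the right half-plane, where [clog] is a right inverse
    of [cexp], and the derivative of [cexp] never vanishes. *)
Lemma Cdiff_clog (z : C) : 0 < Re z -> Cdiff clog z.
Proof.
  intro Hz. apply (Cdiff_right_inverse cexp clog z (Re z)).
  - exact Hz.
  - intros w Hw. apply cexp_clog.
    pose proof (re_le_Cmod (w - z)). rewrite Re_minus in H.
    pose proof (Rle_abs (- (Re w - Re z))). rewrite Rabs_Ropp in H0. lra.
  - apply Ccont_clog. exact Hz.
  - destruct (Caratheodory_cexp (clog z)) as [q [Hq [E H]]].
    exists q. repeat split; auto. rewrite E. apply cexp_neq_0.
Qed.

Lemma Cdiff_cpow (k : R) (z : C) : 0 < Re z -> Cdiff (cpow k) z.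
Proof.
  intro Hz. apply (Cdiff_comp (fun w => k * clog w)%C cexp); [|apply Cdiff_cexp].
  apply (Cdiff_mult (fun _ => RtoC k) clog); [apply Cdiff_const|apply Cdiff_clog; exact Hz].
Qed.

Lemma Cmod_cpow (k : R) (z : C) : Cmod (cpow k z) = Rpower (Cmod z) k.
Proof. unfold cpow. rewrite Cmod_cexp, Re_scal. reflexivity. Qed.

Lemma cpow_1 (k : R) : cpow k 1 = 1%C.
Proof.
  unfold cpow. replace (clog 1) with (RtoC 0).
  - rewrite <- cexp_0. f_equal. ring.
  - unfold clog. rewrite Cmod_1, ln_1. unfold RtoC, Re, Im; simpl.
    rewrite Rdiv_0_l, atan_0. reflexivity.
Qed.

Lemma cos_half_pi_pos (k : R) : 0 <= k < 1 -> 0 < cos (k * (PI / 2)).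
Proof.
  intro Hk. pose proof PI_RGT_0. apply cos_gt_0; nra.
Qed.

(** The argument of z is at most pi/2 in absolute value, so that of z^k is at most k pi/2, and the
    cosine is even and decreasing on [0, pi]. *)
Lemma Re_cpow_ge (k : R) (z : C) : 0 <= k < 1 -> 0 < Re z ->
  cos (k * (PI / 2)) * Rpower (Cmod z) k <= Re (cpow k z).
Proof.
  intros Hk Hz. unfold cpow, cexp. cbn [Re fst]. rewrite Re_scal, Im_scal.
  unfold clog, Rpower. cbn [Re Im fst snd].
  rewrite (Rmult_comm (cos _)).
  apply Rmult_le_compat_l; [left; apply exp_pos|].
  set (t := atan (snd z / fst z)).
  assert (Ht : Rabs t <= PI / 2).
  { pose proof (atan_bound (snd z / fst z)). fold t in H. apply Rabs_le. lra. }
  pose proof PI_RGT_0. change (cos (k * (PI / 2)) <= cos (k * t)).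
  replace (cos (k * t)) with (cos (k * Rabs t)).
  - assert (0 <= k * Rabs t) by (apply Rmult_le_pos; [lra|apply Rabs_pos]).
    assert (k * Rabs t <= k * (PI / 2)) by (apply Rmult_le_compat_l; lra).
    assert (k * (PI / 2) <= 1 * (PI / 2)) by (apply Rmult_le_compat_r; lra).
    destruct (Req_dec (k * Rabs t) (k * (PI / 2))) as [->|n]; [right; reflexivity|].
    left. apply cos_decreasing_1; lra.
  - unfold Rabs. destruct (Rcase_abs t); [|reflexivity].
    replace (k * - t) with (- (k * t)) by ring. apply cos_neg.
Qed.

(** * Cauchy's theorem on squares *)

(* Cousin's lemma; [P x y h] is about the square [x, x+h] x [y, y+h]. *)
Lemma square_induction (P : R -> R -> R -> Prop) (x y h : R) :
  0 < h ->
  (forall x y h, 0 < h -> P x y (h / 2) -> P (x + h / 2) y (h / 2) ->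
     P x (y + h / 2) (h / 2) -> P (x + h / 2) (y + h / 2) (h / 2) -> P x y h) ->
  (forall x0 y0, x <= x0 <= x + h -> y <= y0 <= y + h ->
     exists d, 0 < d /\ forall x' y' h', 0 < h' < d ->
       x' <= x0 <= x' + h' -> y' <= y0 <= y' + h' -> P x' y' h') ->
  P x y h.
Proof.
  intros Hh Hadd Hloc. apply NNPP. intro HP.
  (* Bisection towards a quarter where P fails. The fourth quarter needs no test: if the other three
     satisfy P, it must fail, because otherwise P would hold on the whole square. *)
  set (next := fun t : R * R * R => let '(x, y, h) := t in
    if excluded_middle_informative (P x y (h / 2)) then
      if excluded_middle_informative (P (x + h / 2) y (h / 2)) then
        if excluded_middle_informative (P x (y + h / 2) (h / 2)) then
          (x + h / 2, y + h / 2, h / 2)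
        else (x, y + h / 2, h / 2)
      else (x + h / 2, y, h / 2)
    else (x, y, h / 2)).
  set (sq := fun n => Nat.iter n next (x, y, h)).
  set (X := fun n => fst (fst (sq n))). set (Y := fun n => snd (fst (sq n))).
  set (H := fun n => snd (sq n)).
  assert (Hs : forall n, 0 < H n /\ ~ P (X n) (Y n) (H n) /\ H (S n) = H n / 2 /\
     X n <= X (S n) <= X n + H n / 2 /\ Y n <= Y (S n) <= Y n + H n / 2).
  { assert (Hstep : forall x y h, 0 < h -> ~ P x y h ->
       let t := next (x, y, h) in ~ P (fst (fst t)) (snd (fst t)) (snd t) /\ snd t = h / 2 /\
       x <= fst (fst t) <= x + h / 2 /\ y <= snd (fst t) <= y + h / 2).
    { intros x' y' h' Hh' HP'. unfold next. cbv zeta.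
      destruct (excluded_middle_informative (P x' y' (h' / 2))); cbn [fst snd];
      [destruct (excluded_middle_informative (P (x' + h' / 2) y' (h' / 2))); cbn [fst snd];
       [destruct (excluded_middle_informative (P x' (y' + h' / 2) (h' / 2))); cbn [fst snd]|]|];
      repeat split; try lra; auto. }
    assert (Hinv : forall n, 0 < H n /\ ~ P (X n) (Y n) (H n)).
    { induction n as [|n [IH1 IH2]]; [split; auto|].
      unfold X, Y, H in *. change (sq (S n)) with (next (sq n)).
      destruct (sq n) as [[x' y'] h'] eqn:E. cbn [fst snd] in IH1, IH2.
      destruct (Hstep x' y' h' IH1 IH2) as [K1 [K2 _]]. split; [rewrite K2; lra|exact K1]. }
    intro n. destruct (Hinv n) as [I1 I2]. split; [exact I1|split; [exact I2|]].
    unfold X, Y, H in *. change (sq (S n)) with (next (sq n)).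
    destruct (sq n) as [[x' y'] h'] eqn:E. cbn [fst snd] in I1, I2 |- *.
    destruct (Hstep x' y' h' I1 I2) as [_ K]. exact K. }
  assert (HH : forall n, H n = h / 2 ^ n).
  { induction n as [|n IH]; [unfold H; simpl; field|].
    destruct (Hs n) as [_ [_ [E _]]]. rewrite E, IH. simpl. field.
    apply pow_nonzero. lra. }
  (* Nested intervals in each coordinate: the supremum of the left ends lies in all of them. *)
  assert (lim : forall A : nat -> R, A 0%nat = x \/ A 0%nat = y ->
     (forall n, A n <= A (S n) <= A n + H n / 2) ->
     exists a, forall n, A n <= a <= A n + H n).
  { intros A _ HA.
    assert (K : forall n k, A n <= A (n + k)%nat /\ A (n + k)%nat + H (n + k)%nat <= A n + H n).
    { intros n k. induction k as [|k IH].
      - rewrite Nat.add_0_r. lra.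
      - rewrite Nat.add_succ_r. pose proof (HA (n + k)%nat).
        destruct (Hs (n + k)%nat) as [_ [_ [E _]]]. lra. }
    assert (K2 : forall n m, A m <= A n + H n).
    { intros n m. destruct (Hs (n + m)%nat) as [Hp _]. destruct (K n m) as [_ K1].
      destruct (K m n) as [K3 _]. rewrite Nat.add_comm in K3. lra. }
    destruct (completeness (fun r => exists n, r = A n)) as [a [Ha1 Ha2]].
    - exists (A 0%nat + H 0%nat). intros r [n ->]. apply K2.
    - exists (A 0%nat). exists 0%nat. reflexivity.
    - exists a. intro n. split.
      + apply Ha1. exists n. reflexivity.
      + apply Ha2. intros r [m ->]. apply K2. }
  destruct (lim X (or_introl eq_refl)) as [x0 Hx0]; [intro n; apply Hs|].
  destruct (lim Y (or_intror eq_refl)) as [y0 Hy0]; [intro n; apply Hs|].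
  destruct (Hloc x0 y0) as [d [Hd Hd']].
  { exact (Hx0 0%nat). } { exact (Hy0 0%nat). }
  destruct (pow_lt_1_zero (1 / 2) ltac:(rewrite Rabs_pos_eq; lra) (d / h)) as [N HN].
  { apply Rdiv_lt_0_compat; lra. }
  specialize (HN N (Nat.le_refl N)).
  destruct (Hs N) as [Hp [HnP _]]. apply HnP. apply Hd'; auto.
  split; [exact Hp|]. rewrite HH.
  rewrite Rabs_pos_eq in HN by (apply pow_le; lra).
  replace (1 / 2) with (/ 2) in HN by field. rewrite pow_inv in HN.
  apply (Rmult_lt_compat_r h) in HN; [|exact Hh].
  replace (d / h * h) with d in HN by (field; lra). unfold Rdiv. lra.
Qed.

Lemma RInt_diff_bound (f g : R -> R) (a b c M : R) :
  a <= b -> ex_RInt f a b -> ex_RInt g a b ->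
  (forall t, a <= t <= b -> Rabs (f t - g t - c) <= M) ->
  Rabs (RInt f a b - RInt g a b - c * (b - a)) <= (b - a) * M.
Proof.
  intros Hab Hf Hg HM.
  assert (E1 : @eq R (RInt (fun t => f t - g t) a b) (RInt f a b - RInt g a b))
    by exact (RInt_minus f g a b Hf Hg).
  assert (X1 : ex_RInt (fun t => f t - g t) a b) by exact (ex_RInt_minus f g a b Hf Hg).
  assert (X2 : ex_RInt (fun t => f t - g t - c) a b)
    by exact (ex_RInt_minus _ (fun _ => c) a b X1 (ex_RInt_const a b c)).
  assert (E2 : @eq R (RInt (fun t => f t - g t - c) a b)
               (RInt (fun t => f t - g t) a b - RInt (fun _ => c) a b))
    by exact (RInt_minus _ (fun _ => c) a b X1 (ex_RInt_const a b c)).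
  assert (E3 : @eq R (RInt (fun _ => c) a b) ((b - a) * c)) by exact (RInt_const a b c).
  assert (E : @eq R (RInt f a b - RInt g a b - c * (b - a)) (RInt (fun t => f t - g t - c) a b)) by lra.
  rewrite E.
  apply abs_RInt_le_const; auto.
Qed.

Lemma continuous_along (u : C -> R) (gam : R -> C) (t0 : R) :
  Rcont u (gam t0) -> (forall t, Cmod (gam t - gam t0) <= Rabs (t - t0)) ->
  continuous (fun t => u (gam t)) t0.
Proof.
  intros Hu Hg. apply continuity_pt_filterlim. intros eps He.
  destruct (Hu eps He) as [d [Hd H]]. exists d. split; [exact Hd|].
  intros t [_ Ht]. apply H. eapply Rle_lt_trans; [apply Hg|exact Ht].
Qed.

Lemma Cmod_vertical (s t t0 : R) : Cmod ((s, t) - (s, t0)) <= Rabs (t - t0).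
Proof.
  eapply Rle_trans; [apply Cmod_le_abs|]. unfold Re, Im; simpl.
  replace (s + - s) with 0 by ring. rewrite Rabs_R0. unfold Rminus. lra.
Qed.

Lemma Cmod_horizontal (s s0 t : R) : Cmod ((s, t) - (s0, t)) <= Rabs (s - s0).
Proof.
  eapply Rle_trans; [apply Cmod_le_abs|]. unfold Re, Im; simpl.
  replace (t + - t) with 0 by ring. rewrite Rabs_R0. unfold Rminus. lra.
Qed.

Lemma Rcont_Re_comp (G : C -> C) (z : C) : Ccont G z -> Rcont (fun w => Re (G w)) z.
Proof.
  intros H eps He. destruct (H eps He) as [d [Hd H']]. exists d. split; [exact Hd|].
  intros w Hw. specialize (H' w Hw). pose proof (re_le_Cmod (G w - G z)).
  rewrite Re_minus in H0. lra.
Qed.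

Lemma Rcont_Im_comp (G : C -> C) (z : C) : Ccont G z -> Rcont (fun w => Im (G w)) z.
Proof.
  intros H eps He. destruct (H eps He) as [d [Hd H']]. exists d. split; [exact Hd|].
  intros w Hw. specialize (H' w Hw). pose proof (im_le_Cmod (G w - G z)).
  change (Im (G w - G z)) with (Im (G w) - Im (G z)) in H0. lra.
Qed.

(* Imaginary part of the integral of [G] along the boundary of the square
   [x, x+h] x [y, y+h]. *)
Definition boundary_integral (G : C -> C) (x y h : R) : R :=
  RInt (fun t => Re (G (x + h, t))) y (y + h) - RInt (fun t => Re (G (x, t))) y (y + h)
  - (RInt (fun s => Im (G (s, y + h))) x (x + h) - RInt (fun s => Im (G (s, y))) x (x + h)).

(** The bound eps times the area is additive over quarters and holds for all small squares around a
    point by differentiability there, so it holds for the whole square and every eps. *)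
Lemma goursat_square (G : C -> C) (x y h : R) : 0 < h ->
  (forall s t, x <= s <= x + h -> y <= t <= y + h -> Cdiff G (s, t)) ->
  boundary_integral G x y h = 0.
Proof.
  intros Hh HG.
  assert (exV : forall s a b, x <= s <= x + h -> y <= a -> a <= b -> b <= y + h ->
    ex_RInt (fun t => Re (G (s, t))) a b).
  { intros s a b Hs Ha Hab Hb. apply (ex_RInt_continuous (V := R_CompleteNormedModule)).
    intros t Ht. rewrite Rmin_left, Rmax_right in Ht by exact Hab.
    apply (continuous_along (fun w => Re (G w)) (fun t => (s, t))).
    - apply Rcont_Re_comp, Cdiff_cont, HG; lra.
    - intro. apply Cmod_vertical. }
  assert (exH : forall t a b, y <= t <= y + h -> x <= a -> a <= b -> b <= x + h ->
    ex_RInt (fun s => Im (G (s, t))) a b).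
  { intros t a b Hs Ha Hab Hb. apply (ex_RInt_continuous (V := R_CompleteNormedModule)).
    intros s Ht. rewrite Rmin_left, Rmax_right in Ht by exact Hab.
    apply (continuous_along (fun w => Im (G w)) (fun s => (s, t))).
    - apply Rcont_Im_comp, Cdiff_cont, HG; lra.
    - intro. apply Cmod_horizontal. }
  assert (main : forall eps, 0 < eps -> Rabs (boundary_integral G x y h) <= eps * (h * h)).
  { intros eps He.
    (* The property is conditional on containment in the given square, since the local condition of
       the induction also offers squares that stick out of it, where G need not be
       differentiable. *)
    set (P := fun x' y' h' => x <= x' -> x' + h' <= x + h -> y <= y' -> y' + h' <= y + h ->
      Rabs (boundary_integral G x' y' h') <= eps * (h' * h')).
    enough (HP : P x y h) by (apply HP; lra).
    apply square_induction; [exact Hh| |].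
    - intros x' y' h' Hh' P1 P2 P3 P4 A1 A2 A3 A4.
      specialize (P1 ltac:(lra) ltac:(lra) ltac:(lra) ltac:(lra)).
      specialize (P2 ltac:(lra) ltac:(lra) ltac:(lra) ltac:(lra)).
      specialize (P3 ltac:(lra) ltac:(lra) ltac:(lra) ltac:(lra)).
      specialize (P4 ltac:(lra) ltac:(lra) ltac:(lra) ltac:(lra)).
      assert (cV : forall s, x <= s <= x + h ->
        RInt (fun t => Re (G (s, t))) y' (y' + h') =
        RInt (fun t => Re (G (s, t))) y' (y' + h' / 2) +
        RInt (fun t => Re (G (s, t))) (y' + h' / 2) (y' + h')).
      { intros s Hs. symmetry.
        apply (RInt_Chasles (fun t => Re (G (s, t)))); apply exV; lra. }
      assert (cH : forall t, y <= t <= y + h ->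
        RInt (fun s => Im (G (s, t))) x' (x' + h') =
        RInt (fun s => Im (G (s, t))) x' (x' + h' / 2) +
        RInt (fun s => Im (G (s, t))) (x' + h' / 2) (x' + h')).
      { intros t Ht. symmetry.
        apply (RInt_Chasles (fun s => Im (G (s, t)))); apply exH; lra. }
      assert (E : boundary_integral G x' y' h' =
        boundary_integral G x' y' (h' / 2) + boundary_integral G (x' + h' / 2) y' (h' / 2) +
        boundary_integral G x' (y' + h' / 2) (h' / 2) +
        boundary_integral G (x' + h' / 2) (y' + h' / 2) (h' / 2)).
      { unfold boundary_integral.
        replace (x' + h' / 2 + h' / 2) with (x' + h') by field.
        replace (y' + h' / 2 + h' / 2) with (y' + h') by field.
        rewrite !cV, !cH by lra. ring. }
      rewrite E.
      eapply Rle_trans; [apply Rabs_triang|].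
      eapply Rle_trans; [apply Rplus_le_compat_r, Rabs_triang|].
      eapply Rle_trans; [apply Rplus_le_compat_r, Rplus_le_compat_r, Rabs_triang|].
      replace (eps * (h' * h')) with (4 * (eps * (h' / 2 * (h' / 2)))) by field. lra.
    - intros x0 y0 Hx0 Hy0.
      destruct (Cdiff_eps G (x0, y0) (HG x0 y0 Hx0 Hy0)) as [l Hl].
      (* Points of a small square are within 2 h' of (x0, y0), so on opposite sides the difference
         deviates from its affine model by at most (eps/8) 4 h'. Integration over both pairs of
         sides gives eps h'^2, while the affine model contributes Re l h'^2 to each pair and
         cancels. *)
      destruct (Hl (eps / 8)) as [d [Hd H]]; [lra|].
      exists (d / 2). split; [lra|].
      intros x' y' h' Hh' Hx' Hy' A1 A2 A3 A4.
      assert (HB : forall s t, x' <= s <= x' + h' -> y' <= t <= y' + h' ->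
        Cmod (G (s, t) - G (x0, y0) - l * ((s, t) - (x0, y0))) <= eps / 8 * (2 * h')).
      { intros s t Hs Ht.
        assert (K : Cmod ((s, t) - (x0, y0)) <= 2 * h').
        { eapply Rle_trans; [apply Cmod_le_abs|]. unfold Re, Im; simpl.
          assert (Rabs (s + - x0) <= h') by (apply Rabs_le; lra).
          assert (Rabs (t + - y0) <= h') by (apply Rabs_le; lra). lra. }
        eapply Rle_trans; [apply H; lra|]. apply Rmult_le_compat_l; lra. }
      assert (V1 : Rabs (RInt (fun t => Re (G (x' + h', t))) y' (y' + h')
        - RInt (fun t => Re (G (x', t))) y' (y' + h') - Re l * h' * (y' + h' - y'))
        <= (y' + h' - y') * (eps / 8 * (4 * h'))).
      { apply RInt_diff_bound; [lra|apply exV; lra|apply exV; lra|].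
        intros t Ht.
        pose proof (HB (x' + h') t ltac:(lra) Ht) as B1.
        pose proof (HB x' t ltac:(lra) Ht) as B2.
        pose proof (re_le_Cmod (G (x' + h', t) - G (x0, y0) - l * ((x' + h', t) - (x0, y0)))) as C1.
        pose proof (re_le_Cmod (G (x', t) - G (x0, y0) - l * ((x', t) - (x0, y0)))) as C2.
        assert (E : Re (G (x' + h', t)) - Re (G (x', t)) - Re l * h' =
          Re (G (x' + h', t) - G (x0, y0) - l * ((x' + h', t) - (x0, y0))) -
          Re (G (x', t) - G (x0, y0) - l * ((x', t) - (x0, y0)))).
        { unfold Re; simpl. ring. }
        rewrite E. unfold Rminus at 1.
        eapply Rle_trans; [apply Rabs_triang|]. rewrite Rabs_Ropp. lra. }
      assert (V2 : Rabs (RInt (fun s => Im (G (s, y' + h'))) x' (x' + h')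
        - RInt (fun s => Im (G (s, y'))) x' (x' + h') - Re l * h' * (x' + h' - x'))
        <= (x' + h' - x') * (eps / 8 * (4 * h'))).
      { apply RInt_diff_bound; [lra|apply exH; lra|apply exH; lra|].
        intros s Hs.
        pose proof (HB s (y' + h') Hs ltac:(lra)) as B1.
        pose proof (HB s y' Hs ltac:(lra)) as B2.
        pose proof (im_le_Cmod (G (s, y' + h') - G (x0, y0) - l * ((s, y' + h') - (x0, y0)))) as C1.
        pose proof (im_le_Cmod (G (s, y') - G (x0, y0) - l * ((s, y') - (x0, y0)))) as C2.
        assert (E : Im (G (s, y' + h')) - Im (G (s, y')) - Re l * h' =
          Im (G (s, y' + h') - G (x0, y0) - l * ((s, y' + h') - (x0, y0))) -
          Im (G (s, y') - G (x0, y0) - l * ((s, y') - (x0, y0)))).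
        { unfold Re, Im; simpl. ring. }
        rewrite E. unfold Rminus at 1.
        eapply Rle_trans; [apply Rabs_triang|]. rewrite Rabs_Ropp. lra. }
      unfold boundary_integral. apply Rabs_le_between in V1, V2. apply Rabs_le_between.
      replace (y' + h' - y') with h' in V1 by ring.
      replace (x' + h' - x') with h' in V2 by ring. nra. }
  destruct (Req_dec (boundary_integral G x y h) 0) as [E|E]; [exact E|exfalso].
  apply Rabs_pos_lt in E.
  specialize (main (Rabs (boundary_integral G x y h) / (2 * (h * h)))).
  assert (0 < h * h) by nra.
  assert (M : 0 < Rabs (boundary_integral G x y h) / (2 * (h * h)))
    by (apply Rdiv_lt_0_compat; lra).
  specialize (main M).
  replace (Rabs (boundary_integral G x y h) / (2 * (h * h)) * (h * h))
    with (Rabs (boundary_integral G x y h) / 2) in main by (field; lra).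
  lra.
Qed.

(** * The maximum principle *)

(** The parameter s is the logarithm of the radius: the circle is the image of a vertical segment of
    length 2 pi under z0 + exp. *)
Definition circle_integral (g : C -> C) (z0 : C) (s : R) : R :=
  RInt (fun t => Re (g (z0 + cexp (s, t))%C)) 0 (2 * PI).

Lemma Cdiff_polar (g : C -> C) (z0 : C) (R0 s t : R) :
  (forall z, Cmod (z - z0) < R0 -> Cdiff g z) -> exp s < R0 ->
  Cdiff (fun w => g (z0 + cexp w))%C (s, t).
Proof.
  intros Hg Hs. apply (Cdiff_comp (fun w => z0 + cexp w)%C g).
  - apply Cdiff_plus; [apply Cdiff_const|apply Cdiff_cexp].
  - apply Hg. replace (z0 + cexp (s, t) - z0)%C with (cexp (s, t)) by ring.
    rewrite Cmod_cexp. exact Hs.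
Qed.

Lemma ex_circle_integral (g : C -> C) (z0 : C) (R0 s : R) :
  (forall z, Cmod (z - z0) < R0 -> Cdiff g z) -> exp s < R0 ->
  ex_RInt (fun t => Re (g (z0 + cexp (s, t))%C)) 0 (2 * PI).
Proof.
  intros Hg Hs. apply (ex_RInt_continuous (V := R_CompleteNormedModule)).
  intros t _. apply (continuous_along (fun w => Re (g (z0 + cexp w)%C)) (fun t => (s, t))).
  - apply (Rcont_Re_comp (fun w => g (z0 + cexp w))%C).
    apply Cdiff_cont. apply (Cdiff_polar g z0 R0); auto.
  - intro. apply Cmod_vertical.
Qed.

(** Goursat's theorem for g(z0 + e^w) on a square of side 2 pi: the horizontal sides cancel by
    periodicity, and the vertical ones are the two circle integrals. The side being 2 pi, the radius
    shrinks by e^(-2 pi). *)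
Lemma circle_integral_shift (g : C -> C) (z0 : C) (R0 s : R) :
  (forall z, Cmod (z - z0) < R0 -> Cdiff g z) -> exp s < R0 ->
  circle_integral g z0 (s - 2 * PI) = circle_integral g z0 s.
Proof.
  intros Hg Hs. pose proof PI_RGT_0.
  assert (E : boundary_integral (fun w => g (z0 + cexp w))%C (s - 2 * PI) 0 (2 * PI) = 0).
  { apply goursat_square; [lra|]. intros s' t Hs' _.
    apply (Cdiff_polar g z0 R0); auto.
    eapply Rle_lt_trans; [|exact Hs].
    destruct (Req_dec s' s) as [->|]; [lra|]. left. apply exp_increasing. lra. }
  unfold boundary_integral in E.
  assert (Ep : RInt (fun x => Im (g (z0 + cexp (x, (0 + 2 * PI)%R))%C)) (s - 2 * PI) (s - 2 * PI + 2 * PI)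
    = RInt (fun x => Im (g (z0 + cexp (x, 0))%C)) (s - 2 * PI) (s - 2 * PI + 2 * PI)).
  { apply RInt_ext. intros x _. do 3 f_equal. unfold cexp; cbn [Re Im fst snd].
    rewrite Rplus_0_l, cos_2PI, sin_2PI, cos_0, sin_0. reflexivity. }
  rewrite Ep in E. replace (s - 2 * PI + 2 * PI) with s in E by ring.
  rewrite Rplus_0_l in E. unfold circle_integral. lra.
Qed.

(** Repeated shrinking keeps the mean over the circle unchanged while continuity drives it to the
    value at the centre, which the mean over the original circle misses by mu. *)
Lemma no_strict_max_on_circle (g : C -> C) (z0 : C) (R0 rho mu : R) :
  (forall z, Cmod (z - z0) < R0 -> Cdiff g z) -> 0 < rho < R0 -> 0 < mu ->
  (forall z, Cmod (z - z0) = rho -> Re (g z) <= Re (g z0) - mu) -> False.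
Proof.
  intros Hg Hr Hmu H. pose proof PI_RGT_0 as Hpi.
  set (s := ln rho).
  assert (Es : exp s = rho) by (apply exp_ln; lra).
  assert (Hz0 : Cmod (z0 - z0) < R0) by (rewrite Cmod_sub_0; lra).
  destruct (Rcont_Re_comp g z0 (Cdiff_cont g z0 (Hg z0 Hz0)) (mu / 2)) as [d [Hd Hd']]; [lra|].
  destruct (INR_unbounded ((s - ln d) / (2 * PI))) as [n Hn].
  assert (Hsn : exp (s - INR n * (2 * PI)) < d).
  { rewrite <- (exp_ln d) by exact Hd. apply exp_increasing.
    apply Rlt_div_l in Hn; lra. }
  assert (Hle : forall m, exp (s - INR m * (2 * PI)) <= rho).
  { intro m. rewrite <- Es. pose proof (pos_INR m).
    destruct (Req_dec (s - INR m * (2 * PI)) s) as [->|]; [lra|]. left.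
    apply exp_increasing. assert (0 <= INR m * (2 * PI)) by (apply Rmult_le_pos; lra). lra. }
  assert (Emean : forall m, circle_integral g z0 (s - INR m * (2 * PI)) = circle_integral g z0 s).
  { induction m as [|m IH].
    - simpl. f_equal. ring.
    - rewrite <- IH. rewrite <- (circle_integral_shift g z0 R0 (s - INR m * (2 * PI)) Hg).
      + f_equal. rewrite S_INR. ring.
      + pose proof (Hle m). lra. }
  assert (U : circle_integral g z0 s <= (2 * PI - 0) * (Re (g z0) - mu)).
  { replace ((2 * PI - 0) * (Re (g z0) - mu)) with (RInt (fun _ => Re (g z0) - mu) 0 (2 * PI))
      by exact (RInt_const 0 (2 * PI) (Re (g z0) - mu)).
    apply RInt_le; [lra|apply (ex_circle_integral g z0 R0); [exact Hg|lra]|apply ex_RInt_const|].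
    intros t _. apply H. replace (z0 + cexp (s, t) - z0)%C with (cexp (s, t)) by ring.
    rewrite Cmod_cexp. exact Es. }
  assert (L : (2 * PI - 0) * (Re (g z0) - mu / 2) <= circle_integral g z0 (s - INR n * (2 * PI))).
  { replace ((2 * PI - 0) * (Re (g z0) - mu / 2)) with (RInt (fun _ => Re (g z0) - mu / 2) 0 (2 * PI))
      by exact (RInt_const 0 (2 * PI) (Re (g z0) - mu / 2)).
    apply RInt_le; [lra|apply ex_RInt_const|apply (ex_circle_integral g z0 R0); [exact Hg|]|].
    { pose proof (Hle n). lra. }
    intros t _.
    specialize (Hd' (z0 + cexp ((s - INR n * (2 * PI))%R, t))%C).
    replace (z0 + cexp ((s - INR n * (2 * PI))%R, t) - z0)%C
      with (cexp ((s - INR n * (2 * PI))%R, t)) in Hd' by ring.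
    rewrite Cmod_cexp in Hd'. specialize (Hd' Hsn). apply Rabs_lt_between in Hd'. lra. }
  rewrite (Emean n) in L. nra.
Qed.

(** Compactness by way of Cousin's lemma: without a maximum, u near each point stays below one of
    its own larger values, hence below a single one on a square containing the whole set, which is
    absurd. *)
Lemma max_attained (rho u : C -> R) (z1 : C) :
  (forall z, Rcont rho z) -> (forall z, 0 <= rho z -> Cmod z <= 1) ->
  (forall z, 0 <= rho z -> Rcont u z) -> 0 <= rho z1 ->
  exists z0, 0 <= rho z0 /\ forall z, 0 <= rho z -> u z <= u z0.
Proof.
  intros Hr Hb Hu H1. apply NNPP. intro Hn.
  assert (Hbig : forall z, 0 <= rho z -> exists z', 0 <= rho z' /\ u z < u z').
  { intros z Hz. apply NNPP. intro K. apply Hn. exists z. split; [exact Hz|].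
    intros z' Hz'. apply Rnot_lt_le. intro. apply K. exists z'. auto. }
  set (P := fun x y h : R => exists z', 0 <= rho z' /\ forall z, 0 <= rho z ->
    x <= Re z <= x + h -> y <= Im z <= y + h -> u z <= u z').
  assert (HP : P (-1) (-1) 2).
  { apply square_induction; [lra| |].
    - intros x y h Hh P1 P2 P3 P4.
      assert (join : forall A B : C -> Prop,
        (exists z', 0 <= rho z' /\ forall z, A z -> u z <= u z') ->
        (exists z', 0 <= rho z' /\ forall z, B z -> u z <= u z') ->
        exists z', 0 <= rho z' /\ forall z, A z \/ B z -> u z <= u z').
      { intros A B [a [Ha Ha']] [b [Hb0 Hb']]. destruct (Rle_lt_dec (u a) (u b)).
        - exists b. split; [exact Hb0|]. intros z [K|K]; [apply Ha' in K; lra|auto].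
        - exists a. split; [exact Ha|]. intros z [K|K]; [auto|apply Hb' in K; lra]. }
      set (S := fun x y h z => 0 <= rho z /\ x <= Re z <= x + h /\ y <= Im z <= y + h).
      assert (conv : forall x y h, P x y h -> exists z', 0 <= rho z' /\ forall z, S x y h z -> u z <= u z').
      { intros x' y' h' [z' [K1 K2]]. exists z'. split; [exact K1|]. intros z [L1 [L2 L3]]. auto. }
      destruct (join _ _ (join _ _ (conv _ _ _ P1) (conv _ _ _ P2))
                         (join _ _ (conv _ _ _ P3) (conv _ _ _ P4))) as [z' [K1 K2]].
      exists z'. split; [exact K1|]. intros z Hz Hx Hy. apply K2. unfold S.
      destruct (Rle_lt_dec (Re z) (x + h / 2)); destruct (Rle_lt_dec (Im z) (y + h / 2)).
      + left; left. repeat split; lra.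
      + right; left. repeat split; lra.
      + left; right. repeat split; lra.
      + right; right. repeat split; lra.
    - intros x0 y0 _ _.
      assert (loc : exists z' d, 0 <= rho z' /\ 0 < d /\ forall z, Cmod (z - (x0, y0)) < d ->
         0 <= rho z -> u z <= u z').
      { destruct (Rle_lt_dec 0 (rho (x0, y0))) as [H0|H0].
        - destruct (Hbig _ H0) as [z' [Hz' Hlt]].
          destruct (Hu _ H0 (u z' - u (x0, y0))) as [d [Hd Hd']]; [lra|].
          exists z', d. repeat split; auto. intros z Hz _. specialize (Hd' z Hz).
          apply Rabs_lt_between in Hd'. lra.
        - destruct (Hr (x0, y0) (- rho (x0, y0))) as [d [Hd Hd']]; [lra|].
          (* Near a point with negative [rho] the set is empty, and [z1] is only a default
             witness. *)
          exists z1, d. repeat split; auto. intros z Hz Hz'. specialize (Hd' z Hz).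
          apply Rabs_lt_between in Hd'. lra. }
      destruct loc as [z' [d [Hz' [Hd Hd']]]]. exists (d / 2). split; [lra|].
      intros x' y' h' Hh' Hx Hy. exists z'. split; [exact Hz'|].
      intros z Hz Hx' Hy'. apply Hd'; [|exact Hz].
      eapply Rle_lt_trans; [apply Cmod_le_abs|].
      change (Rabs (Re z - x0) + Rabs (Im z - y0) < d).
      assert (Rabs (Re z - x0) <= h') by (apply Rabs_le; lra).
      assert (Rabs (Im z - y0) <= h') by (apply Rabs_le; lra). lra. }
  destruct HP as [z' [Hz' K]]. destruct (Hbig z' Hz') as [z2 [Hz2 Hlt]].
  assert (u z2 <= u z'); [|lra]. apply K; [exact Hz2| |].
  - pose proof (re_le_Cmod z2). apply Hb in Hz2.
    assert (Ha : Rabs (Re z2) <= 1) by lra. apply Rabs_le_between in Ha. lra.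
  - pose proof (im_le_Cmod z2). apply Hb in Hz2.
    assert (Ha : Rabs (Im z2) <= 1) by lra. apply Rabs_le_between in Ha. lra.
Qed.

(** The small term eta |z|^2 makes |g|^2 strictly subharmonic, so the maximum of the sum cannot sit
    where [rho] is positive. The set where [rho] vanishes plays the part of the boundary. *)
Lemma maximum_principle (rho : C -> R) (g : C -> C) :
  (forall z, Rcont rho z) -> (forall z, 0 <= rho z -> Cmod z < 1) ->
  (forall z, Cmod z < 1 -> Cdiff g z) ->
  (forall z, rho z = 0 -> Cmod (g z) <= 1) ->
  forall z, 0 <= rho z -> Cmod (g z) <= 1.
Proof.
  intros Hr Hb Hg H1 z1 Hz1. apply Rnot_lt_le. intro Hlt.
  (* Half of the excess at [z1]: on the boundary u is at most 1 + eta, while u z1 >= 1 + 2 eta. *)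
  set (eta := (Cmod (g z1) ^ 2 - 1) / 2).
  assert (Heta : 0 < eta) by (unfold eta; simpl; nra).
  set (u := fun z => Cmod (g z) * Cmod (g z) + eta * (Cmod z * Cmod z)).
  destruct (max_attained rho u z1) as [z0 [Hz0 Hmax]]; auto.
  { intros z Hz. left. auto. }
  { intros z Hz.
    assert (Cg : Rcont (fun w => Cmod (g w)) z).
    { intros eps He. destruct (Cdiff_cont g z (Hg z (Hb z Hz)) eps He) as [d [Hd K]].
      exists d. split; [exact Hd|]. intros w Hw. specialize (K w Hw).
      pose proof (Cmod_triangle_rev (g w) (g z)). pose proof (Cmod_triangle_rev (g z) (g w)) as T.
      rewrite (Cmod_sub_sym (g z)) in T. apply Rabs_lt_between. lra. }
    apply Rcont_plus; [apply Rcont_mult; exact Cg|].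
    apply (Rcont_mult (fun _ => eta) (fun w => Cmod w * Cmod w)); [apply Rcont_const|].
    apply Rcont_mult; apply Rcont_Cmod. }
  pose proof (Cmod_ge_0 z0) as P0. pose proof (Hb z0 Hz0) as L0.
  pose proof (Cmod_ge_0 (g z0)) as Pg.
  destruct (Req_dec (rho z0) 0) as [E|E].
  { pose proof (H1 z0 E). specialize (Hmax z1 Hz1). unfold u in Hmax.
    assert (Cmod (g z0) * Cmod (g z0) <= 1) by nra.
    assert (eta * (Cmod z0 * Cmod z0) <= eta * 1) by (apply Rmult_le_compat_l; nra).
    assert (0 <= eta * (Cmod z1 * Cmod z1)).
    { apply Rmult_le_pos; [lra|]. apply Rmult_le_pos; apply Cmod_ge_0. }
    unfold eta in *. simpl in *. lra. }
  destruct (Hr z0 (rho z0)) as [d [Hd Hd']]; [lra|].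
  assert (Hin : forall z, Cmod (z - z0) < d -> 0 <= rho z).
  { intros z Hz. specialize (Hd' z Hz). apply Rabs_lt_between in Hd'. lra. }
  (* On a circle around [z0], [|g z|^2 <= |g z0|^2 + eta (|z0|^2 - |z|^2)] bounds the real
     part of [conj (g z0) g z + eta conj z0 z] strictly below its value at [z0]. *)
  apply (no_strict_max_on_circle (fun z => Cconj (g z0) * g z + eta * (Cconj z0 * z))%C
     z0 d (d / 2) (eta * (d / 2 * (d / 2)) / 2)); [|lra| |].
  - intros z Hz. apply Cdiff_plus; (apply Cdiff_mult; [apply Cdiff_const|]).
    + apply Hg, Hb, Hin, Hz.
    + apply Cdiff_mult; [apply Cdiff_const|apply Cdiff_id].
  - assert (0 < d / 2 * (d / 2)) by nra. apply Rdiv_lt_0_compat; nra.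
  - intros z Hz. specialize (Hmax z (Hin z ltac:(lra))). unfold u in Hmax.
    rewrite !Cmod_sqr in Hmax.
    assert (E2 : Cmod (z - z0) * Cmod (z - z0) = d / 2 * (d / 2)) by (rewrite Hz; reflexivity).
    rewrite Cmod_sqr in E2.
    rewrite !Re_plus, !Re_scal. unfold Cconj, Re, Im in *; simpl in *.
    set (a := fst (g z0)) in *. set (b := snd (g z0)) in *.
    set (p := fst (g z)) in *. set (q := snd (g z)) in *.
    (* These squares bound 2 Re(conj(g z0) g z) by |g z0|^2 + |g z|^2. For the other term 2 Re(conj
       z0 z) = |z0|^2 + |z|^2 - |z - z0|^2, and the last summand is the strict drop. *)
    pose proof (Rle_0_sqr (a - p)). pose proof (Rle_0_sqr (b - q)). unfold Rsqr in *.
    rewrite <- E2. lra.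
Qed.

(** * Division by zeros and Jensen's inequality *)

(** Local divisibility by (z - a)^m, the form that is inherited by quotients at the remaining
    zeros. *)
Definition factors_at (f : C -> C) (a : C) (m : nat) : Prop :=
  exists (g : C -> C) (rho : R), 0 < rho /\
    (forall z, Cmod (z - a) < rho -> Cdiff g z) /\
    forall z, Cmod (z - a) < rho -> f z = ((z - a) ^ m * g z)%C.

Lemma zero_mult_factors_at (f : C -> C) (a : C) (m : nat) :
  zero_mult f a m -> factors_at f a m.
Proof.
  intros [g [rho [H0 [Hg [_ Hf]]]]]. exists g, rho. split; [exact H0|split].
  - intros z Hz. apply C_differentiable_Cdiff. auto.
  - exact Hf.
Qed.

Lemma Csub_neq_0 (a b : C) : a <> b -> (a - b)%C <> 0%C.
Proof. intro H. apply Cmod_gt_0. apply Cmod_sub_neq. exact H. Qed.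

(** The quotient is f/(z - a)^m away from a and agrees with the local cofactor near a, which removes
    the singularity. At another point b the factorization persists on a disk about b that avoids
    a. *)
Lemma divide_zero (D : C -> Prop) (f : C -> C) (a : C) (m : nat) :
  (forall z, D z -> Cdiff f z) -> factors_at f a m ->
  exists F, (forall z, D z -> Cdiff F z) /\ (forall z, f z = ((z - a) ^ m * F z)%C) /\
    forall b k, b <> a -> factors_at f b k -> factors_at F b k.
Proof.
  intros Hf [g [rho [Hrho [Hg E]]]].
  set (F := fun z => if excluded_middle_informative (z = a) then g a
                     else (f z / (z - a) ^ m)%C).
  assert (FE : forall z, z <> a -> F z = (f z / (z - a) ^ m)%C).
  { intros z Hz. unfold F. destruct (excluded_middle_informative (z = a)); congruence. }
  assert (Fa : F a = g a).
  { unfold F. destruct (excluded_middle_informative (a = a)); congruence. }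
  assert (Fg : forall z, Cmod (z - a) < rho -> F z = g z).
  { intros z Hz. destruct (classic (z = a)) as [->|n]; [exact Fa|].
    rewrite (FE z n), (E z Hz). field. apply Cpow_nz, Csub_neq_0, n. }
  exists F. split; [|split].
  - intros z Hz. destruct (classic (z = a)) as [->|n].
    + apply (Cdiff_ext_loc g F a rho Hrho).
      * intros w Hw. symmetry. auto.
      * apply Hg. rewrite Cmod_sub_0. exact Hrho.
    + apply (Cdiff_ext_loc (fun z => f z / (z - a) ^ m)%C F z (Cmod (z - a))).
      * apply Cmod_sub_neq. exact n.
      * intros w Hw. symmetry. apply FE. intros ->. rewrite Cmod_sub_sym in Hw. lra.
      * apply Cdiff_div; [auto| |apply Cpow_nz, Csub_neq_0, n].
        apply (Cdiff_pow (fun z => z - a)%C).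
        apply Cdiff_minus; [apply Cdiff_id|apply Cdiff_const].
  - intro z. destruct (classic (z = a)) as [->|n].
    + rewrite Fa. apply E. rewrite Cmod_sub_0. exact Hrho.
    + rewrite (FE z n). field. apply Cpow_nz, Csub_neq_0, n.
  - intros b k Hb [g' [rho' [Hrho' [Hg' E']]]].
    pose proof (Cmod_sub_neq b a Hb) as Hba.
    exists (fun z => g' z / (z - a) ^ m)%C, (Rmin rho' (Cmod (b - a))).
    pose proof (Rmin_l rho' (Cmod (b - a))). pose proof (Rmin_r rho' (Cmod (b - a))).
    assert (Hna : forall z, Cmod (z - b) < Rmin rho' (Cmod (b - a)) -> z <> a).
    { intros z Hz ->. rewrite Cmod_sub_sym in Hz. lra. }
    split; [apply Rmin_pos; auto|split].
    + intros z Hz. apply Cdiff_div; [apply Hg'; lra| |apply Cpow_nz, Csub_neq_0, Hna, Hz].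
      apply (Cdiff_pow (fun z => z - a)%C).
      apply Cdiff_minus; [apply Cdiff_id|apply Cdiff_const].
    + intros z Hz. rewrite (FE z) by (apply Hna; exact Hz). rewrite (E' z) by lra.
      field. apply Cpow_nz, Csub_neq_0, Hna, Hz.
Qed.

(** The factor [b] is left open so that the product of the z - a and that of their boundary
    substitutes can be compared factor by factor. *)
Definition zprod (b : C -> C -> C) (l : list (C * nat)) (z : C) : C :=
  fold_right (fun am acc => b (fst am) z ^ snd am * acc)%C 1%C l.

Lemma divide_zeros (D : C -> Prop) (l : list (C * nat)) : forall f : C -> C,
  (forall z, D z -> Cdiff f z) -> NoDup (map fst l) ->
  (forall am, In am l -> factors_at f (fst am) (snd am)) ->
  exists F, (forall z, D z -> Cdiff F z) /\
    forall z, f z = (zprod (fun a z => z - a)%C l z * F z)%C.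
Proof.
  induction l as [|[a m] l IH]; intros f Hf Hnd Hm.
  - exists f. split; [exact Hf|]. intro z. simpl. ring.
  - destruct (divide_zero D f a m Hf (Hm _ (or_introl eq_refl))) as [F1 [H1 [E1 K1]]].
    simpl in Hnd. apply NoDup_cons_iff in Hnd as [Hna Hnd].
    destruct (IH F1 H1 Hnd) as [F [HF E]].
    + intros am Ham. apply K1; [|apply Hm; right; exact Ham].
      intro Eq. apply Hna. rewrite <- Eq. apply in_map. exact Ham.
    + exists F. split; [exact HF|]. intro z. rewrite E1, E. simpl. ring.
Qed.

Lemma Cdiff_zprod (b : C -> C -> C) (l : list (C * nat)) (z : C) :
  (forall am, In am l -> Cdiff (b (fst am)) z) -> Cdiff (zprod b l) z.
Proof.
  induction l as [|[a m] l IH]; intro H.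
  - exact (Cdiff_const 1%C z).
  - apply (Cdiff_mult (fun z => b a z ^ m)%C (zprod b l)).
    + apply Cdiff_pow. exact (H (a, m) (or_introl eq_refl)).
    + apply IH. intros am Ham. apply H. right. exact Ham.
Qed.

Lemma Cmod_zprod_le (b b' : C -> C -> C) (l : list (C * nat)) (z : C) :
  (forall am, In am l -> Cmod (b (fst am) z) <= Cmod (b' (fst am) z)) ->
  Cmod (zprod b l z) <= Cmod (zprod b' l z).
Proof.
  induction l as [|[a m] l IH]; intro H; simpl; [lra|].
  rewrite !Cmod_mult, !Cmod_pow.
  apply Rmult_le_compat; [apply pow_le, Cmod_ge_0|apply Cmod_ge_0| |].
  - apply pow_incr. split; [apply Cmod_ge_0|]. exact (H (a, m) (or_introl eq_refl)).
  - apply IH. intros am Ham. apply H. right. exact Ham.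
Qed.

Definition lsum (g : C * nat -> R) (l : list (C * nat)) : R :=
  fold_right (fun am acc => g am + acc) 0 l.

Lemma Cmod_zprod_exp (b b' : C -> C -> C) (e : C -> R) (l : list (C * nat)) (z : C) :
  (forall am, In am l -> Cmod (b (fst am) z) * exp (e (fst am)) <= Cmod (b' (fst am) z)) ->
  Cmod (zprod b l z) * exp (lsum (fun am => INR (snd am) * e (fst am)) l) <= Cmod (zprod b' l z).
Proof.
  induction l as [|[a m] l IH]; intro H; simpl.
  - rewrite exp_0. lra.
  - rewrite !Cmod_mult, !Cmod_pow, exp_plus.
    replace (Cmod (b a z) ^ m * Cmod (zprod b l z) *
      (exp (INR m * e a) * exp (lsum (fun am => INR (snd am) * e (fst am)) l)))
      with ((Cmod (b a z) ^ m * exp (INR m * e a)) *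
      (Cmod (zprod b l z) * exp (lsum (fun am => INR (snd am) * e (fst am)) l))) by ring.
    assert (Ee : exp (INR m * e a) = exp (e a) ^ m).
    { clear. induction m as [|m IH]; [simpl; rewrite Rmult_0_l; apply exp_0|].
      rewrite S_INR, Rmult_plus_distr_r, Rmult_1_l, exp_plus, IH. simpl. ring. }
    rewrite Ee, <- Rpow_mult_distr.
    apply Rmult_le_compat.
    + apply pow_le, Rmult_le_pos; [apply Cmod_ge_0|left; apply exp_pos].
    + apply Rmult_le_pos; [apply Cmod_ge_0|left; apply exp_pos].
    + apply pow_incr. split.
      * apply Rmult_le_pos; [apply Cmod_ge_0|left; apply exp_pos].
      * exact (H (a, m) (or_introl eq_refl)).
    + apply IH. intros am Ham. apply H. right. exact Ham.
Qed.

(* Jensen's inequality on [rho > 0]: each [h zeta] is a harmonic correction dominating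
   the logarithm of the reciprocal Blaschke factor on the boundary [rho = 0]. *)
Lemma jensen_inequality (rho : C -> R) (f H : C -> C) (h : C -> C -> C) (l : list (C * nat)) :
  (forall z, Rcont rho z) -> (forall z, 0 <= rho z -> Cmod z < 1) -> 0 <= rho 0%C ->
  (forall z, Cmod z < 1 -> Cdiff f z) -> Cmod (f 0%C) = 1 ->
  (forall z, Cmod z < 1 -> Cdiff H z) ->
  NoDup (map fst l) ->
  (forall am, In am l -> Cmod (fst am) < 1 /\ factors_at f (fst am) (snd am)) ->
  (forall am z, In am l -> Cmod z < 1 -> Cdiff (h (fst am)) z) ->
  (forall am z, In am l -> rho z = 0 ->
     Cmod (1 - Cconj (fst am) * z) * exp (- Re (h (fst am) z)) <= Cmod (z - fst am)) ->
  (forall am, In am l -> Re (h (fst am) 0%C) <= (1 - Cmod (fst am)) / 2) ->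
  (forall z, rho z = 0 -> f z <> 0%C -> ln (Cmod (f z)) <= Re (H z)) ->
  lsum (fun am => INR (snd am) * (1 - Cmod (fst am))) l <= 2 * Re (H 0%C).
Proof.
  intros Hr Hb H0 Hf Hf0 HH Hnd Hl Hh Hbd Hz0 HfH.
  destruct (divide_zeros (fun z => Cmod z < 1) l f Hf Hnd) as [F [HF E]].
  { intros am Ham. apply Hl. exact Ham. }
  (* The substitute for z - a: at most |z - a| in modulus on the boundary, but at 0 at least |a|
     exp((1 - |a|)/2). This gap at 0 is what bounds the sum. *)
  set (b := fun a z => ((1 - Cconj a * z) * cexp (- h a z))%C).
  set (z0 := fun a z : C => (z - a)%C).
  assert (Hbm : forall a z, Cmod (b a z) = Cmod (1 - Cconj a * z) * exp (- Re (h a z))).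
  { intros a z. unfold b. rewrite Cmod_mult, Cmod_cexp. reflexivity. }
  assert (key : forall z, 0 <= rho z -> Cmod (F z * zprod b l z * cexp (- H z)) <= 1).
  { apply (maximum_principle rho (fun z => F z * zprod b l z * cexp (- H z))%C); auto.
    - intros z Hz. apply Cdiff_mult; [apply Cdiff_mult; [auto|]|].
      + apply Cdiff_zprod. intros am Ham. unfold b. apply Cdiff_mult.
        * apply Cdiff_minus; [apply Cdiff_const|]. apply Cdiff_mult; [apply Cdiff_const|apply Cdiff_id].
        * apply (Cdiff_comp (fun z => - h (fst am) z)%C cexp); [|apply Cdiff_cexp].
          apply Cdiff_opp. auto.
      + apply (Cdiff_comp (fun z => - H z)%C cexp); [|apply Cdiff_cexp]. apply Cdiff_opp. auto.
    - intros z Hz. rewrite !Cmod_mult, Cmod_cexp.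
      change (Re (- H z)) with (- Re (H z)).
      assert (P : Cmod (zprod b l z) <= Cmod (zprod z0 l z)).
      { apply Cmod_zprod_le. intros am Ham. rewrite Hbm. apply Hbd; auto. }
      assert (P2 : Cmod (F z) * Cmod (zprod b l z) <= Cmod (f z)).
      { rewrite (E z), Cmod_mult, Rmult_comm. apply Rmult_le_compat_r; [apply Cmod_ge_0|exact P]. }
      (* The growth hypothesis is silent at zeros of f on the boundary; there the product
         vanishes. *)
      destruct (classic (f z = 0%C)) as [Z|Z].
      + rewrite Z, Cmod_0 in P2.
        assert (P3 : 0 <= Cmod (F z) * Cmod (zprod b l z)) by (apply Rmult_le_pos; apply Cmod_ge_0).
        replace (Cmod (F z) * Cmod (zprod b l z)) with 0 by lra. lra.
      + specialize (HfH z Hz Z). apply Cmod_gt_0 in Z.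
        assert (P4 : Cmod (f z) <= exp (Re (H z))).
        { rewrite <- (exp_ln (Cmod (f z))) by exact Z.
          destruct HfH as [HfH| ->]; [left; apply exp_increasing; exact HfH|lra]. }
        rewrite exp_Ropp. apply Rle_div_l; [apply exp_pos|]. lra. }
  specialize (key 0%C H0). rewrite !Cmod_mult, Cmod_cexp in key.
  change (Re (- H 0%C)) with (- Re (H 0%C)) in key.
  rewrite exp_Ropp in key. apply Rle_div_l in key; [|apply exp_pos].
  rewrite (E 0%C), Cmod_mult in Hf0.
  pose proof (Cmod_zprod_exp z0 b (fun a => (1 - Cmod a) / 2) l 0%C) as Q.
  assert (Q' : exp (lsum (fun am => INR (snd am) * ((1 - Cmod (fst am)) / 2)) l) <= exp (Re (H 0%C))).
  { set (S := lsum (fun am => INR (snd am) * ((1 - Cmod (fst am)) / 2)) l) in *.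
    fold z0 in Hf0.
    assert (Q1 : Cmod (zprod z0 l 0%C) * exp S <= Cmod (zprod b l 0%C));
      [apply Q|apply (Rmult_le_compat_l (Cmod (F 0%C))) in Q1; [|apply Cmod_ge_0];
        replace (Cmod (F 0%C) * (Cmod (zprod z0 l 0%C) * exp S))
          with ((Cmod (zprod z0 l 0%C) * Cmod (F 0%C)) * exp S) in Q1 by ring;
        rewrite Hf0 in Q1; lra].
    intros am Ham. rewrite Hbm. unfold z0.
    replace (0 - fst am)%C with (- fst am)%C by ring. rewrite Cmod_opp.
    replace (1 - Cconj (fst am) * 0)%C with (RtoC 1) by ring. rewrite Cmod_1, Rmult_1_l.
    set (d := 1 - Cmod (fst am)).
    (* This is log(1/|a|) >= d. As the correction takes at most d/2 at 0, a factor exp(d/2) remains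
       for each zero, and these factors multiply to the exponential of half the sum. *)
    assert (Cmod (fst am) <= exp (- d)).
    { pose proof (exp_ineq1_le (- d)). unfold d in *. lra. }
    apply Rle_trans with (exp (- d) * exp (d / 2)).
    - apply Rmult_le_compat_r; [left; apply exp_pos|exact H1].
    - rewrite <- exp_plus. specialize (Hz0 am Ham). fold d in Hz0.
      destruct (Req_dec (- d + d / 2) (- Re (h (fst am) 0%C))) as [->|]; [lra|].
      left. apply exp_increasing. lra. }
  assert (Q2 : lsum (fun am => INR (snd am) * ((1 - Cmod (fst am)) / 2)) l <= Re (H 0%C)).
  { apply Rnot_lt_le. intro K. apply exp_increasing in K. lra. }
  assert (Q3 : lsum (fun am => INR (snd am) * (1 - Cmod (fst am))) l =
    2 * lsum (fun am => INR (snd am) * ((1 - Cmod (fst am)) / 2)) l).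
  { clear. induction l as [|am l IH]; simpl; [ring|]. rewrite IH. field. }
  lra.
Qed.

(** * Distances and Blaschke factors *)

Lemma Rpower_pos (x a : R) : 0 < Rpower x a.
Proof. apply exp_pos. Qed.

Lemma Rpower_le_base (x y a : R) : 0 <= a -> 0 < x <= y -> Rpower x a <= Rpower y a.
Proof. intros Ha Hx. apply Rle_Rpower_l; lra. Qed.

Lemma Rpower_le_1 (x a : R) : 0 <= a -> 0 < x <= 1 -> Rpower x a <= 1.
Proof. intros Ha Hx. rewrite <- (rpower_1_base a) at 2 || idtac.
  apply Rle_trans with (Rpower 1 a); [apply Rpower_le_base; lra|].
  unfold Rpower. rewrite ln_1, Rmult_0_r, exp_0. lra.
Qed.

Lemma Rpower_1_le (x a : R) : 0 <= a -> 1 <= x -> 1 <= Rpower x a.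
Proof.
  intros Ha Hx. apply Rle_trans with (Rpower 1 a); [|apply Rpower_le_base; lra].
  unfold Rpower. rewrite ln_1, Rmult_0_r, exp_0. lra.
Qed.

Lemma Rpower_anti_exponent (x a b : R) : 0 < x <= 1 -> a <= b -> Rpower x b <= Rpower x a.
Proof.
  intros Hx Hab. replace b with (a + (b - a)) by ring. rewrite Rpower_plus.
  pose proof (Rpower_le_1 x (b - a) ltac:(lra) Hx). pose proof (Rpower_pos x a). nra.
Qed.

Lemma fold_Rmin_le (z : C) (l : list C) : forall m,
  fold_left (fun acc v => Rmin acc (Cmod (z - v))) l m <= m /\
  (forall w, In w l -> fold_left (fun acc v => Rmin acc (Cmod (z - v))) l m <= Cmod (z - w)) /\
  (fold_left (fun acc v => Rmin acc (Cmod (z - v))) l m = m \/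
   exists w, In w l /\ fold_left (fun acc v => Rmin acc (Cmod (z - v))) l m = Cmod (z - w)).
Proof.
  induction l as [|v l IH]; intro m; simpl.
  - repeat split; [lra|tauto|auto].
  - destruct (IH (Rmin m (Cmod (z - v)))) as [H1 [H2 H3]].
    pose proof (Rmin_l m (Cmod (z - v))). pose proof (Rmin_r m (Cmod (z - v))).
    repeat split; [lra| |].
    + intros w [->|Hw]; [lra|auto].
    + destruct H3 as [H3|[w [Hw H3]]]; [|right; exists w; auto].
      rewrite H3. unfold Rmin. destruct (Rle_dec m (Cmod (z - v))); [auto|].
      right. exists v. auto.
Qed.

Lemma dist_set_le (z : C) (l : list C) (w : C) : In w l -> dist_set z l <= Cmod (z - w).
Proof.
  destruct l as [|v l]; [intros []|]. unfold dist_set.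
  destruct (fold_Rmin_le z l (Cmod (z - v))) as [H1 [H2 _]].
  intros [->|H]; auto.
Qed.

Lemma dist_set_attained (z : C) (l : list C) : l <> nil ->
  exists w, In w l /\ dist_set z l = Cmod (z - w).
Proof.
  destruct l as [|v l]; [congruence|]. intros _. unfold dist_set.
  destruct (fold_Rmin_le z l (Cmod (z - v))) as [_ [_ [H|[w [Hw H]]]]].
  - exists v. simpl. auto.
  - exists w. simpl. auto.
Qed.

Lemma dist_set_triangle (z z' : C) (l : list C) : l <> nil ->
  dist_set z l <= dist_set z' l + Cmod (z - z').
Proof.
  intro Hl. destruct (dist_set_attained z' l Hl) as [w [Hw E]]. rewrite E.
  pose proof (dist_set_le z l w Hw). pose proof (Cmod_sub_triangle z z' w). lra.
Qed.

Lemma Rcont_dist_set (l : list C) (z : C) : l <> nil -> Rcont (fun z => dist_set z l) z.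
Proof.
  intro Hl. apply Rcont_lipschitz. intro w. apply Rabs_le.
  pose proof (dist_set_triangle w z l Hl). pose proof (dist_set_triangle z w l Hl).
  rewrite (Cmod_sub_sym z w) in H0. lra.
Qed.

Lemma dist_set_circle (l : list C) (z : C) : l <> nil -> (forall w, In w l -> Cmod w = 1) ->
  1 - Cmod z <= dist_set z l <= 1 + Cmod z.
Proof.
  intros Hl H1. destruct (dist_set_attained z l Hl) as [w [Hw E]]. rewrite E.
  pose proof (Cmod_triangle_rev w z). rewrite (Cmod_sub_sym w z), (H1 w Hw) in H.
  pose proof (Cmod_triangle z (- w)). rewrite Cmod_opp, (H1 w Hw) in H0.
  unfold Cminus in *. lra.
Qed.

Lemma Rcont_Rmin (u v : C -> R) (z : C) : Rcont u z -> Rcont v z ->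
  Rcont (fun w => Rmin (u w) (v w)) z.
Proof.
  intros Hu Hv eps He.
  destruct (Hu eps He) as [d1 [Hd1 H1]]. destruct (Hv eps He) as [d2 [Hd2 H2]].
  exists (Rmin d1 d2). split; [apply Rmin_pos; auto|]. intros w Hw.
  pose proof (Rmin_l d1 d2). pose proof (Rmin_r d1 d2).
  specialize (H1 w ltac:(lra)). specialize (H2 w ltac:(lra)).
  apply Rabs_lt_between in H1, H2. apply Rabs_lt_between.
  unfold Rmin. destruct (Rle_dec (u w) (v w)), (Rle_dec (u z) (v z)); lra.
Qed.

Lemma Rcont_Rmax_const (u : C -> R) (t : R) (z : C) : Rcont u z ->
  Rcont (fun w => Rmax (u w) t) z.
Proof.
  intros Hu eps He. destruct (Hu eps He) as [d1 [Hd1 H1]].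
  exists d1. split; [exact Hd1|]. intros w Hw. specialize (H1 w Hw).
  apply Rabs_lt_between in H1. apply Rabs_lt_between.
  unfold Rmax. destruct (Rle_dec (u w) t), (Rle_dec (u z) t); lra.
Qed.

Lemma continuity_pt_Rpower (k x : R) : 0 < x -> continuity_pt (fun x => Rpower x k) x.
Proof.
  intro Hx. apply derivable_continuous_pt. exists (k * Rpower x (k - 1)).
  apply derivable_pt_lim_power. exact Hx.
Qed.

(** The polynomial form of the identity for 1 - |b|^2, b the Blaschke factor of a. *)
Lemma Cmod_sub_sqr (a z : C) :
  Cmod (z - a) * Cmod (z - a) = Cmod (1 - Cconj a * z) * Cmod (1 - Cconj a * z)
    - (1 - Cmod z * Cmod z) * (1 - Cmod a * Cmod a).
Proof. rewrite !Cmod_sqr. unfold Re, Im; simpl. ring. Qed.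

(* [ln (1 / |b|) <= B] for the Blaschke factor [b], since [|b|^2 = 1 - y] and
   [1 - y >= exp (- 2 y)] when [y <= 1/2]. *)
Lemma blaschke_lower_bound (a z : C) (B : R) : Cmod a < 1 -> Cmod z < 1 ->
  4 * (1 - Cmod z) * (1 - Cmod a) <= Cmod (1 - Cconj a * z) * Cmod (1 - Cconj a * z) / 2 ->
  4 * (1 - Cmod z) * (1 - Cmod a) <= Cmod (1 - Cconj a * z) * Cmod (1 - Cconj a * z) * B ->
  Cmod (1 - Cconj a * z) * exp (- B) <= Cmod (z - a).
Proof.
  intros Ha Hz H1 H2. pose proof (Cmod_sub_sqr a z) as E.
  pose proof (Cmod_ge_0 a) as Pa. pose proof (Cmod_ge_0 z) as Pz.
  pose proof (Cmod_ge_0 (z - a)) as Pza.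
  set (W := Cmod (1 - Cconj a * z)) in *. set (m := Cmod (z - a)) in *.
  set (ra := Cmod a) in *. set (rz := Cmod z) in *.
  assert (P : 0 < (1 - rz) * (1 - ra)) by nra.
  assert (HW0 : 0 <= W) by apply Cmod_ge_0.
  assert (HW : 0 < W * W) by lra.
  set (y := (1 - rz * rz) * (1 - ra * ra) / (W * W)).
  assert (Ey : (1 - rz * rz) * (1 - ra * ra) = y * (W * W)) by (unfold y; field; nra).
  assert (L : (1 - rz * rz) * (1 - ra * ra) <= 4 * (1 - rz) * (1 - ra)).
  { replace ((1 - rz * rz) * (1 - ra * ra)) with ((1 - rz) * (1 - ra) * ((1 + rz) * (1 + ra))) by ring.
    assert ((1 + rz) * (1 + ra) <= 2 * 2) by (apply Rmult_le_compat; lra). nra. }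
  assert (y1 : y <= 1 / 2) by (apply Rmult_le_reg_r with (W * W); [exact HW|lra]).
  assert (y2 : y <= B) by (apply Rmult_le_reg_r with (W * W); [exact HW|lra]).
  assert (y0 : 0 <= y).
  { unfold y. apply Rdiv_le_0_compat; [|exact HW]. apply Rmult_le_pos; nra. }
  assert (Ex : exp (- B) * exp (- B) <= 1 - y).
  { rewrite <- exp_plus. replace (- B + - B) with (- (2 * B)) by ring. rewrite exp_Ropp.
    pose proof (exp_ineq1_le (2 * B)).
    apply Rle_trans with (/ (1 + 2 * y)).
    - apply Rinv_le_contravar; lra.
    - apply Rmult_le_reg_l with (1 + 2 * y); [lra|]. rewrite Rinv_r by lra. nra. }
  pose proof (exp_pos (- B)).
  apply Rsqr_incr_0_var; [|exact Pza]. unfold Rsqr.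
  replace (W * exp (- B) * (W * exp (- B))) with (W * W * (exp (- B) * exp (- B))) by ring.
  rewrite E, Ey. nra.
Qed.

(** * Real parts of reciprocals and the kernel adapted to E *)

Lemma Re_Cinv (z : C) : Re (/ z) = Re z / (Cmod z * Cmod z).
Proof. rewrite Cmod_sqr. unfold Re, Im; simpl. f_equal. ring. Qed.

Lemma Re_one_sub_ge (a z : C) : Cmod a <= 1 -> Cmod z < 1 ->
  1 - Cmod z <= Re (1 - Cconj a * z).
Proof.
  intros Ha Hz. rewrite Re_minus. change (Re 1%C) with 1.
  pose proof (Re_le_Cmod (Cconj a * z)) as H. rewrite Cmod_mult, Cmod_conj in H.
  pose proof (Cmod_ge_0 z). nra.
Qed.

Lemma Re_one_sub_ge_l (a z : C) : Cmod a < 1 -> Cmod z < 1 ->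
  1 - Cmod a <= Re (1 - Cconj a * z).
Proof.
  intros Ha Hz. rewrite Re_minus. change (Re 1%C) with 1.
  pose proof (Re_le_Cmod (Cconj a * z)) as H. rewrite Cmod_mult, Cmod_conj in H.
  pose proof (Cmod_ge_0 a). nra.
Qed.

Lemma Cmod_one_sub_circle (xi z : C) : Cmod xi = 1 -> Cmod (1 - Cconj xi * z) = Cmod (z - xi).
Proof.
  intro H. pose proof (Cmod_sub_sqr xi z) as E. rewrite H in E.
  pose proof (Cmod_ge_0 (z - xi)). pose proof (Cmod_ge_0 (1 - Cconj xi * z)). nra.
Qed.

Lemma Re_neq_0 (z : C) : 0 < Re z -> z <> 0%C.
Proof. intros H ->. simpl in H. lra. Qed.

Lemma Re_pos_Cmod (z : C) : 0 < Re z -> 0 < Cmod z.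
Proof. intro H. apply Cmod_gt_0, Re_neq_0, H. Qed.

Definition csum (g : C -> C -> C) (l : list C) (z : C) : C :=
  fold_right (fun a acc => g a z + acc)%C 0%C l.

Lemma Cdiff_csum (g : C -> C -> C) (l : list C) (z : C) :
  (forall a, In a l -> Cdiff (g a) z) -> Cdiff (csum g l) z.
Proof.
  induction l as [|a l IH]; intro H.
  - exact (Cdiff_const 0%C z).
  - apply (Cdiff_plus (g a) (csum g l)); [apply H; left; reflexivity|].
    apply IH. intros b Hb. apply H. right. exact Hb.
Qed.

Lemma Re_csum_nonneg (g : C -> C -> C) (l : list C) (z : C) :
  (forall a, In a l -> 0 <= Re (g a z)) -> 0 <= Re (csum g l z).
Proof.
  induction l as [|b l IH]; intro H; [simpl; lra|].
  change (0 <= Re (g b z) + Re (csum g l z)).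
  pose proof (H b (or_introl eq_refl)).
  assert (0 <= Re (csum g l z)) by (apply IH; intros c Hc; apply H; right; exact Hc). lra.
Qed.

Lemma Re_csum_ge (g : C -> C -> C) (l : list C) (z a : C) :
  (forall a, In a l -> 0 <= Re (g a z)) -> In a l -> Re (g a z) <= Re (csum g l z).
Proof.
  induction l as [|b l IH]; intros H Ha; [destruct Ha|].
  change (Re (g a z) <= Re (g b z) + Re (csum g l z)).
  assert (H' : forall a, In a l -> 0 <= Re (g a z)) by (intros c Hc; apply H; right; exact Hc).
  pose proof (Re_csum_nonneg g l z H'). pose proof (H b (or_introl eq_refl)).
  destruct Ha as [->|Ha]; [lra|]. specialize (IH H' Ha). lra.
Qed.

Lemma Re_csum_eq (g : C -> C -> C) (l : list C) (z : C) (c : R) :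
  (forall a, Re (g a z) = c) -> Re (csum g l z) = INR (length l) * c.
Proof.
  intro H. induction l as [|a l IH]; [simpl; ring|].
  change (Re (g a z) + Re (csum g l z) = INR (S (length l)) * c).
  rewrite S_INR, H, IH. ring.
Qed.

(* With [w = 1 - conj zeta z] and [b = (1 - |zeta|)^(1 - k)], the real part dominates
   [b |w|^(k - 2)] (a lower bound that [Re (1 / w)] alone does not satisfy), and the value
   at [0] stays below [1]. *)
Definition thin_kernel (k : R) (zeta z : C) : C :=
  (/ ((1 - Cconj zeta * z)
      + Rpower (1 - Cmod zeta) (1 - k) * cpow k (1 - Cconj zeta * z)))%C.

Lemma Re_thin_denominator (k : R) (a z : C) : 0 <= k < 1 -> Cmod a < 1 -> Cmod z < 1 ->
  cos (k * (PI / 2)) * (Rpower (1 - Cmod a) (1 - k) * Rpower (Cmod (1 - Cconj a * z)) k) <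
  Re ((1 - Cconj a * z) + Rpower (1 - Cmod a) (1 - k) * cpow k (1 - Cconj a * z))%C.
Proof.
  intros Hk Ha Hz. rewrite Re_plus, Re_scal.
  pose proof (Re_one_sub_ge_l a z Ha Hz).
  pose proof (Re_cpow_ge k (1 - Cconj a * z) Hk ltac:(lra)).
  apply (Rmult_le_compat_l (Rpower (1 - Cmod a) (1 - k))) in H0; [|left; apply Rpower_pos]. lra.
Qed.

Lemma Cmod_one_sub_ge (a z : C) : Cmod a < 1 -> Cmod z < 1 -> 1 - Cmod a <= Cmod (1 - Cconj a * z).
Proof.
  intros Ha Hz. pose proof (Re_one_sub_ge_l a z Ha Hz).
  pose proof (Re_le_Cmod (1 - Cconj a * z)). lra.
Qed.

Lemma Rpower_interpolate (x y k : R) : 0 <= k < 1 -> 0 < x <= y ->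
  x <= Rpower x (1 - k) * Rpower y k <= y.
Proof.
  intros Hk Hx. split.
  - rewrite <- (Rpower_1 x) at 1 by lra. replace 1 with ((1 - k) + k) at 1 by ring.
    rewrite Rpower_plus. apply Rmult_le_compat_l; [left; apply Rpower_pos|].
    apply Rpower_le_base; lra.
  - rewrite <- (Rpower_1 y) at 2 by lra. replace 1 with ((1 - k) + k) at 2 by ring.
    rewrite Rpower_plus. apply Rmult_le_compat_r; [left; apply Rpower_pos|].
    apply Rpower_le_base; lra.
Qed.

(** The real part of 1/N is Re N/|N|^2. The power term is no larger than |w| because 1 - |a| <= |w|,
    so |N| <= 2|w|, while it alone supplies the lower bound for Re N. *)
Lemma Re_thin_kernel_ge (k : R) (a z : C) : 0 <= k < 1 -> Cmod a < 1 -> Cmod z < 1 ->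
  cos (k * (PI / 2)) * (Rpower (1 - Cmod a) (1 - k) * Rpower (Cmod (1 - Cconj a * z)) k)
    <= 4 * (Cmod (1 - Cconj a * z) * Cmod (1 - Cconj a * z)) * Re (thin_kernel k a z).
Proof.
  intros Hk Ha Hz. unfold thin_kernel. rewrite Re_Cinv.
  pose proof (Re_thin_denominator k a z Hk Ha Hz) as HR.
  pose proof (Cmod_one_sub_ge a z Ha Hz) as Hw.
  pose proof (Rpower_interpolate (1 - Cmod a) (Cmod (1 - Cconj a * z)) k Hk ltac:(lra)) as [_ HI].
  set (N := ((1 - Cconj a * z) + Rpower (1 - Cmod a) (1 - k) * cpow k (1 - Cconj a * z))%C) in *.
  assert (HN : Cmod N <= 2 * Cmod (1 - Cconj a * z)).
  { unfold N. eapply Rle_trans; [apply Cmod_triangle|].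
    rewrite Cmod_mult, Cmod_cpow, Cmod_R, Rabs_pos_eq by (left; apply Rpower_pos). lra. }
  set (X := cos (k * (PI / 2)) * (Rpower (1 - Cmod a) (1 - k) * Rpower (Cmod (1 - Cconj a * z)) k)) in *.
  assert (HX : 0 < X).
  { unfold X. apply Rmult_lt_0_compat; [apply cos_half_pi_pos; exact Hk|].
    apply Rmult_lt_0_compat; apply Rpower_pos. }
  pose proof (Re_pos_Cmod N ltac:(lra)) as PN.
  set (W := Cmod (1 - Cconj a * z)) in *.
  replace (4 * (W * W) * (Re N / (Cmod N * Cmod N)))
    with ((4 * (W * W)) / (Cmod N * Cmod N) * Re N) by (field; lra).
  assert (1 <= (4 * (W * W)) / (Cmod N * Cmod N)).
  { apply Rle_div_r; nra. }
  nra.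
Qed.

Lemma Cdiff_thin_kernel (k : R) (a z : C) : 0 <= k < 1 -> Cmod a < 1 -> Cmod z < 1 ->
  Cdiff (thin_kernel k a) z.
Proof.
  intros Hk Ha Hz.
  assert (Dw : Cdiff (fun z => 1 - Cconj a * z)%C z).
  { apply Cdiff_minus; [apply Cdiff_const|]. apply Cdiff_mult; [apply Cdiff_const|apply Cdiff_id]. }
  apply Cdiff_inv.
  - apply Cdiff_plus; [exact Dw|]. apply Cdiff_mult; [apply Cdiff_const|].
    apply (Cdiff_comp (fun z => 1 - Cconj a * z)%C (cpow k)); [exact Dw|].
    apply Cdiff_cpow. pose proof (Re_one_sub_ge_l a z Ha Hz). lra.
  - apply Re_neq_0. eapply Rlt_trans; [|apply Re_thin_denominator; auto].
    apply Rmult_lt_0_compat; [apply cos_half_pi_pos; exact Hk|].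
    apply Rmult_lt_0_compat; apply Rpower_pos.
Qed.

Lemma thin_kernel_0 (k : R) (a : C) : 0 <= Re (thin_kernel k a 0) <= 1.
Proof.
  unfold thin_kernel. replace (1 - Cconj a * 0)%C with (RtoC 1) by ring.
  rewrite cpow_1. replace (1 + Rpower (1 - Cmod a) (1 - k) * 1)%C
    with (RtoC (1 + Rpower (1 - Cmod a) (1 - k))) by (rewrite RtoC_plus; ring).
  pose proof (Rpower_pos (1 - Cmod a) (1 - k)).
  rewrite Re_Cinv, Cmod_R, Rabs_pos_eq by lra.
  cbn [Re RtoC fst].
  replace ((1 + Rpower (1 - Cmod a) (1 - k)) / ((1 + Rpower (1 - Cmod a) (1 - k)) * (1 + Rpower (1 - Cmod a) (1 - k))))
    with (/ (1 + Rpower (1 - Cmod a) (1 - k))) by (field; lra).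
  split.
  - left. apply Rinv_0_lt_compat. lra.
  - apply Rle_trans with (/ 1); [apply Rinv_le_contravar; lra|lra].
Qed.

(** * Zeros in one layer *)

(** Here d and D are the distances of the zero to the circle and to E, W = |w|, and M is the floored
    distance of the boundary point to E, so that c M^k is 1 - |z|. Up to a factor 2, M is at most
    the larger of D and W. If D <= W, then d <= D gives A c <= d^(1-k); otherwise A c D^k <= d <=
    d^(1-k) W^k. *)
Lemma profile_bound (k A c d D W M : R) :
  0 <= k < 1 -> 0 < A -> 0 < c -> 0 < d <= D -> d <= W -> 0 < M <= D + W ->
  A * c * Rpower D k <= d ->
  A * (c * Rpower M k) <= 2 * (Rpower d (1 - k) * Rpower W k).
Proof.
  intros Hk HA Hc Hd HW HM H.
  assert (HAc : 0 < A * c) by (apply Rmult_lt_0_compat; lra).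
  assert (dbl : forall x, 0 < x -> M <= 2 * x -> Rpower M k <= 2 * Rpower x k).
  { intros x Hx HMx. apply Rle_trans with (Rpower (2 * x) k); [apply Rpower_le_base; lra|].
    rewrite <- Rpower_mult_distr by lra.
    apply Rmult_le_compat_r; [left; apply Rpower_pos|].
    rewrite <- (Rpower_1 2) at 2 by lra. apply Rle_Rpower; lra. }
  assert (Ed : Rpower d (1 - k) * Rpower d k = d).
  { rewrite <- Rpower_plus. replace (1 - k + k) with 1 by ring. apply Rpower_1. lra. }
  destruct (Rle_lt_dec D W) as [L|L].
  - assert (A * c <= Rpower d (1 - k)).
    { apply Rmult_le_reg_r with (Rpower d k); [apply Rpower_pos|]. rewrite Ed.
      eapply Rle_trans; [|exact H]. apply Rmult_le_compat_l; [lra|]. apply Rpower_le_base; lra. }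
    specialize (dbl W ltac:(lra) ltac:(lra)). pose proof (Rpower_pos W k).
    apply (Rmult_le_compat_l (A * c)) in dbl; [|lra]. nra.
  - specialize (dbl D ltac:(lra) ltac:(lra)).
    pose proof (Rpower_interpolate d W k Hk ltac:(lra)).
    apply (Rmult_le_compat_l (A * c)) in dbl; [|lra]. lra.
Qed.

(** For |xi| = 1 its real part is (1 + P)/2, with P the Poisson kernel of the disk at xi. *)
Definition pole (xi z : C) : C := (/ (1 - Cconj xi * z))%C.

Lemma Re_pole_ge (xi z : C) : Cmod xi = 1 -> Cmod z < 1 ->
  0 < Re (pole xi z) /\ 1 - Cmod z <= Cmod (z - xi) * Cmod (z - xi) * Re (pole xi z).
Proof.
  intros Hxi Hz. unfold pole. rewrite Re_Cinv.
  pose proof (Re_one_sub_ge xi z ltac:(lra) Hz) as HR.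
  pose proof (Re_pos_Cmod (1 - Cconj xi * z) ltac:(lra)) as HP.
  rewrite Cmod_one_sub_circle in * by exact Hxi.
  assert (0 < Cmod (z - xi) * Cmod (z - xi)) by nra.
  split; [apply Rdiv_lt_0_compat; lra|].
  replace (Cmod (z - xi) * Cmod (z - xi) * (Re (1 - Cconj xi * z) / (Cmod (z - xi) * Cmod (z - xi))))
    with (Re (1 - Cconj xi * z)) by (field; lra). exact HR.
Qed.

Lemma Cdiff_pole (xi z : C) : Cmod xi = 1 -> Cmod z < 1 -> Cdiff (pole xi) z.
Proof.
  intros Hxi Hz. apply Cdiff_inv.
  - apply Cdiff_minus; [apply Cdiff_const|]. apply Cdiff_mult; [apply Cdiff_const|apply Cdiff_id].
  - apply Re_neq_0. pose proof (Re_one_sub_ge xi z ltac:(lra) Hz). lra.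
Qed.

Lemma Re_pole_0 (xi : C) : Re (pole xi 0) = 1.
Proof.
  unfold pole. replace (1 - Cconj xi * 0)%C with (RtoC 1) by ring.
  rewrite Re_Cinv, Cmod_1. cbn [Re RtoC fst]. field.
Qed.

Lemma Re_thin_kernel_pos (k : R) (a z : C) : 0 <= k < 1 -> Cmod a < 1 -> Cmod z < 1 ->
  0 < Re (thin_kernel k a z).
Proof.
  intros Hk Ha Hz. pose proof (Re_thin_kernel_ge k a z Hk Ha Hz).
  pose proof (Cmod_one_sub_ge a z Ha Hz).
  assert (0 < cos (k * (PI / 2)) * (Rpower (1 - Cmod a) (1 - k) * Rpower (Cmod (1 - Cconj a * z)) k)).
  { apply Rmult_lt_0_compat; [apply cos_half_pi_pos; exact Hk|].
    apply Rmult_lt_0_compat; apply Rpower_pos. }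
  assert (0 < 4 * (Cmod (1 - Cconj a * z) * Cmod (1 - Cconj a * z))) by nra.
  apply Rnot_le_lt. intro. nra.
Qed.

Definition correction (k al : R) (F : list C) (zeta z : C) : C :=
  (RtoC (al * (1 - Cmod zeta)) * (thin_kernel k zeta z + csum pole F z))%C.

Lemma Re_correction (k al : R) (F : list C) (zeta z : C) :
  Re (correction k al F zeta z) =
  al * (1 - Cmod zeta) * (Re (thin_kernel k zeta z) + Re (csum pole F z)).
Proof. unfold correction. rewrite Re_scal. reflexivity. Qed.

(** By [profile_bound], A (1 - |z|) is at most twice d^(1-k) |w|^k, which the thin kernel sees in
    its real part. Then A >= 16 gives the smallness required by [blaschke_lower_bound], and the
    bound 32 lets the coefficient [al] suffice for the domination. *)
Lemma correction_near_E (k al A c t : R) (E F : list C) (zeta z : C) :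
  0 <= k < 1 -> 0 < al -> 16 <= A -> 32 <= A * (al * cos (k * (PI / 2))) -> 0 < c ->
  E <> nil -> (forall w, In w E -> Cmod w = 1) -> (forall w, In w F -> Cmod w = 1) ->
  Cmod zeta < 1 -> Cmod z < 1 -> 0 < t <= dist_set zeta E ->
  A * c * Rpower (dist_set zeta E) k <= 1 - Cmod zeta ->
  1 - Cmod z = c * Rpower (Rmax (dist_set z E) t) k ->
  Cmod (1 - Cconj zeta * z) * exp (- Re (correction k al F zeta z)) <= Cmod (z - zeta).
Proof.
  intros Hk Hal HA HA2 Hc HE HE1 HF1 Hze Hz Ht Hd Hb.
  pose proof (dist_set_circle E zeta HE HE1) as HD.
  pose proof (dist_set_triangle z zeta E HE) as HT.
  pose proof (Cmod_one_sub_ge zeta z Hze Hz) as HW.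
  pose proof (Cmod_sub_sqr zeta z) as Esq.
  pose proof (Cmod_ge_0 (z - zeta)) as P1. pose proof (Cmod_ge_0 z) as Pz.
  pose proof (Cmod_ge_0 zeta) as Pze.
  assert (Hzw : Cmod (z - zeta) <= Cmod (1 - Cconj zeta * z)).
  { assert (0 < (1 - Cmod z * Cmod z) * (1 - Cmod zeta * Cmod zeta))
      by (apply Rmult_lt_0_compat; nra). nra. }
  pose proof (profile_bound k A c (1 - Cmod zeta) (dist_set zeta E) (Cmod (1 - Cconj zeta * z))
    (Rmax (dist_set z E) t) Hk ltac:(lra) Hc ltac:(lra) HW) as PB.
  assert (PB' : A * (1 - Cmod z) <= 2 * (Rpower (1 - Cmod zeta) (1 - k) * Rpower (Cmod (1 - Cconj zeta * z)) k)).
  { rewrite Hb. apply PB; [|exact Hd]. split.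
    - pose proof (Rmax_r (dist_set z E) t). lra.
    - apply Rmax_lub; lra. }
  pose proof (Rpower_interpolate (1 - Cmod zeta) (Cmod (1 - Cconj zeta * z)) k Hk ltac:(lra)) as [_ HI].
  pose proof (Re_thin_kernel_ge k zeta z Hk Hze Hz) as HK.
  pose proof (Re_thin_kernel_pos k zeta z Hk Hze Hz) as HKp.
  pose proof (cos_half_pi_pos k Hk) as Hcos.
  pose proof (Re_csum_nonneg pole F z) as Hs.
  assert (Hs' : 0 <= Re (csum pole F z)).
  { apply Hs. intros xi Hxi. left. apply Re_pole_ge; auto. }
  set (X := Rpower (1 - Cmod zeta) (1 - k) * Rpower (Cmod (1 - Cconj zeta * z)) k) in *.
  assert (HX : 0 < X) by (apply Rmult_lt_0_compat; apply Rpower_pos).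
  set (W := Cmod (1 - Cconj zeta * z)) in *. set (d := 1 - Cmod zeta) in *.
  set (dz := 1 - Cmod z) in *. set (g := cos (k * (PI / 2))) in *.
  assert (Hdz : 16 * dz <= 2 * X) by (assert (0 <= dz) by (unfold dz; lra); nra).
  apply blaschke_lower_bound; auto; fold W d dz.
  - assert (dz * d <= (X / 8) * W) by (apply Rmult_le_compat; unfold d, dz in *; lra).
    assert (X * W <= W * W) by (apply Rmult_le_compat_r; lra). lra.
  - rewrite Re_correction. fold d.
    set (T := Re (thin_kernel k zeta z)) in *.
    apply Rle_trans with (W * W * (al * d * T)).
    + assert (HT4 : al * (g * X) <= al * (4 * (W * W) * T)) by (apply Rmult_le_compat_l; lra).
      assert (H32 : 32 * dz <= 2 * (al * g) * X).
      { apply Rle_trans with (A * (al * g) * dz).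
        - apply Rmult_le_compat_r; unfold dz; lra.
        - assert (0 < al * g) by (apply Rmult_lt_0_compat; lra).
          apply (Rmult_le_compat_l (al * g)) in PB'; [|lra]. lra. }
      assert (16 * dz <= 4 * (W * W) * (al * T)) by lra.
      assert (Hd0 : 0 < d) by (unfold d; lra).
      apply (Rmult_le_compat_r d) in H; [|lra]. lra.
    + apply Rmult_le_compat_l; [nra|]. apply Rmult_le_compat_l; [|lra].
      apply Rmult_le_pos; unfold d; lra.
Qed.

(** The point xi of F nearest to z contributes a real part of at least (1 - |z|)/s^2, whereas the
    zero is at distance at least A s from F, so |w| >= A s/2 and log(1/|b|) is smaller by the order
    of A^2. *)
Lemma correction_near_F (k al A s : R) (F : list C) (zeta z : C) :
  0 <= k < 1 -> 0 < al -> 16 <= A -> 16 <= al * A -> 0 < s ->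
  F <> nil -> (forall w, In w F -> Cmod w = 1) ->
  Cmod zeta < 1 -> Cmod z < 1 -> A * s <= dist_set zeta F -> dist_set z F = s ->
  Cmod (1 - Cconj zeta * z) * exp (- Re (correction k al F zeta z)) <= Cmod (z - zeta).
Proof.
  intros Hk Hal HA HA2 Hs HF HF1 Hze Hz Hd Hb.
  destruct (dist_set_attained z F HF) as [xi [Hxi Exi]].
  pose proof (dist_set_circle F z HF HF1) as HDz.
  pose proof (dist_set_triangle zeta z F HF) as HT.
  pose proof (Cmod_one_sub_ge zeta z Hze Hz) as HW.
  pose proof (Cmod_sub_sqr zeta z) as Esq.
  pose proof (Cmod_ge_0 (z - zeta)) as P1. pose proof (Cmod_ge_0 z) as Pz.
  pose proof (Cmod_ge_0 zeta) as Pze.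
  rewrite (Cmod_sub_sym zeta z) in HT.
  assert (Hzw : Cmod (z - zeta) <= Cmod (1 - Cconj zeta * z)).
  { assert (0 < (1 - Cmod z * Cmod z) * (1 - Cmod zeta * Cmod zeta))
      by (apply Rmult_lt_0_compat; nra). nra. }
  pose proof (Re_thin_kernel_pos k zeta z Hk Hze Hz) as HKp.
  assert (Hpole : Re (pole xi z) <= Re (csum pole F z)).
  { apply Re_csum_ge; [|exact Hxi]. intros a Ha. left. apply Re_pole_ge; auto. }
  destruct (Re_pole_ge xi z (HF1 xi Hxi) Hz) as [Hp0 Hp]. rewrite <- Exi, Hb in Hp.
  set (W := Cmod (1 - Cconj zeta * z)) in *. set (d := 1 - Cmod zeta) in *.
  assert (Hd0 : 0 < d) by (unfold d; lra).
  assert (H16 : 16 * s <= A * s) by (apply Rmult_le_compat_r; lra).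
  assert (HWs : A * s <= 2 * W) by lra.
  assert (HW2 : A * s * (A * s) <= 2 * W * (2 * W)) by (apply Rmult_le_compat; lra).
  apply blaschke_lower_bound; auto; fold W d.
  - assert ((1 - Cmod z) * d <= (W / 8) * W) by (apply Rmult_le_compat; lra). lra.
  - rewrite Re_correction. fold d.
    set (S := Re (csum pole F z)) in *. set (T := Re (thin_kernel k zeta z)) in *.
    apply Rle_trans with (W * W * (al * d * Re (pole xi z))).
    + set (P := Re (pole xi z)) in *.
      assert (Ha2 : 16 * 16 <= (al * A) * A) by (apply Rmult_le_compat; lra).
      assert (16 * (1 - Cmod z) <= 4 * (W * W) * (al * P)).
      { apply Rle_trans with (A * s * (A * s) * (al * P)); [|replace (4 * (W * W)) with (2 * W * (2 * W)) by ring].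
        - apply Rle_trans with (((al * A) * A) * (s * s * P)); [|lra].
          apply Rmult_le_compat; lra.
        - apply Rmult_le_compat_r; [|exact HW2]. apply Rmult_le_pos; lra. }
      apply (Rmult_le_compat_r d) in H; [|lra]. lra.
    + apply Rmult_le_compat_l; [nra|]. apply Rmult_le_compat_l; [|lra].
      apply Rmult_le_pos; lra.
Qed.

(** * The growth hypothesis on the boundary and its harmonic majorant *)

(** With dz = 1 - |z| and e, fF the distances to E and F: the power of e left over has exponent r -
    k p in [0, r] and e <= 2, whence 2^r; of the power q of fF only q' is kept, the rest being at
    most s^(-Q). *)
Lemma growth_bound (K p q r k q' Q c s dz e fF : R) :
  0 <= p -> 0 <= r -> k * p <= r -> 0 <= k -> q' <= q -> q - q' <= Q -> 0 < K ->
  0 < c -> 0 < s < 1 -> 0 < e <= 2 -> c * Rpower e k <= dz -> s <= fF ->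
  K / Rpower dz p * Rpower e r / Rpower fF q <=
  K * Rpower 2 r * (Rpower c (- p) * Rpower s (- Q)) * / Rpower fF q'.
Proof.
  intros Hp Hr Hkp Hk Hq HQ HK Hc Hs He Hdz HfF.
  pose proof (Rpower_pos e k) as P1. pose proof (Rpower_pos dz p) as P2.
  pose proof (Rpower_pos fF q) as P3. pose proof (Rpower_pos fF q') as P4.
  assert (B1 : / Rpower dz p * Rpower e r <= Rpower c (- p) * Rpower 2 r).
  { assert (B0 : / Rpower dz p <= Rpower c (- p) * Rpower e (- (k * p))).
    { apply Rle_trans with (/ Rpower (c * Rpower e k) p).
      - apply Rinv_le_contravar; [apply Rpower_pos|]. apply Rpower_le_base; [exact Hp|].
        split; [apply Rmult_lt_0_compat; lra|exact Hdz].
      - rewrite <- Rpower_mult_distr, Rpower_mult by lra.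
        rewrite Rinv_mult, <- !Rpower_Ropp. right. reflexivity. }
    apply Rle_trans with (Rpower c (- p) * Rpower e (- (k * p)) * Rpower e r).
    - apply Rmult_le_compat_r; [left; apply Rpower_pos|exact B0].
    - rewrite Rmult_assoc, <- Rpower_plus. apply Rmult_le_compat_l; [left; apply Rpower_pos|].
      apply Rle_trans with (Rpower 2 (- (k * p) + r)).
      + apply Rpower_le_base; lra.
      + apply Rle_Rpower; [lra|]. assert (0 <= k * p) by (apply Rmult_le_pos; lra). lra. }
  assert (B2 : / Rpower fF q <= Rpower s (- Q) * / Rpower fF q').
  { replace q with (q' + (q - q')) at 1 by ring. rewrite Rpower_plus, Rinv_mult.
    rewrite (Rmult_comm (/ Rpower fF q')).
    apply Rmult_le_compat_r; [left; apply Rinv_0_lt_compat, Rpower_pos|].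
    apply Rle_trans with (/ Rpower s (q - q')).
    - apply Rinv_le_contravar; [apply Rpower_pos|]. apply Rpower_le_base; lra.
    - rewrite <- Rpower_Ropp. apply Rpower_anti_exponent; lra. }
  replace (K / Rpower dz p * Rpower e r / Rpower fF q)
    with (K * ((/ Rpower dz p * Rpower e r) * / Rpower fF q)) by (unfold Rdiv; ring).
  replace (K * Rpower 2 r * (Rpower c (- p) * Rpower s (- Q)) * / Rpower fF q')
    with (K * ((Rpower c (- p) * Rpower 2 r) * (Rpower s (- Q) * / Rpower fF q'))) by ring.
  apply Rmult_le_compat_l; [lra|]. apply Rmult_le_compat; try assumption.
  - apply Rmult_le_pos; [left; apply Rinv_0_lt_compat; lra|left; apply Rpower_pos].
  - left. apply Rinv_0_lt_compat. lra.
Qed.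

Definition power_pole (q : R) (xi z : C) : C := (/ cpow q (1 - Cconj xi * z))%C.

(** Below the exponent 1 the real part is comparable to the modulus in all of the disk, tangential
    directions included. *)
Lemma Re_power_pole_ge (q : R) (xi z : C) : 0 <= q < 1 -> Cmod xi = 1 -> Cmod z < 1 ->
  cos (q * (PI / 2)) * / Rpower (Cmod (z - xi)) q <= Re (power_pole q xi z).
Proof.
  intros Hq Hxi Hz. unfold power_pole. rewrite Re_Cinv, Cmod_cpow.
  pose proof (Re_one_sub_ge xi z ltac:(lra) Hz) as HR.
  pose proof (Re_cpow_ge q (1 - Cconj xi * z) Hq ltac:(lra)) as H.
  rewrite Cmod_one_sub_circle in * by exact Hxi.
  pose proof (Rpower_pos (Cmod (z - xi)) q) as P. set (X := Rpower (Cmod (z - xi)) q) in *.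
  replace (cos (q * (PI / 2)) * / X) with (cos (q * (PI / 2)) * X / (X * X)) by (field; lra).
  apply Rmult_le_compat_r; [left; apply Rinv_0_lt_compat; nra|exact H].
Qed.

Lemma Cdiff_power_pole (q : R) (xi z : C) : Cmod xi = 1 -> Cmod z < 1 ->
  Cdiff (power_pole q xi) z.
Proof.
  intros Hxi Hz. apply (Cdiff_inv (fun z => cpow q (1 - Cconj xi * z))).
  - apply (Cdiff_comp (fun z => 1 - Cconj xi * z)%C (cpow q)).
    + apply Cdiff_minus; [apply Cdiff_const|]. apply Cdiff_mult; [apply Cdiff_const|apply Cdiff_id].
    + apply Cdiff_cpow. pose proof (Re_one_sub_ge xi z ltac:(lra) Hz). lra.
  - apply cexp_neq_0.
Qed.

Lemma Re_power_pole_0 (q : R) (xi : C) : Re (power_pole q xi 0) = 1.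
Proof.
  unfold power_pole. replace (1 - Cconj xi * 0)%C with (RtoC 1) by ring.
  rewrite cpow_1, Re_Cinv, Cmod_1. cbn [Re RtoC fst]. field.
Qed.

Lemma exists_lower_bound (u : C * nat -> R) (l : list (C * nat)) :
  (forall am, In am l -> 0 < u am) ->
  exists t, 0 < t <= 1 /\ forall am, In am l -> t <= u am.
Proof.
  induction l as [|a l IH]; intro H.
  - exists 1. split; [lra|]. intros am [].
  - destruct IH as [t [Ht K]]; [intros am Ham; apply H; right; exact Ham|].
    exists (Rmin t (u a)). pose proof (Rmin_l t (u a)). pose proof (Rmin_r t (u a)).
    split.
    + split; [apply Rmin_pos; [lra|apply H; left; reflexivity]|lra].
    + intros am [->|Ham]; [lra|]. specialize (K am Ham). lra.
Qed.

(** The order of quantifiers is the point: A and B are fixed before f, K, the levels and the family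
    of zeros, so they can enter the final constant. *)
Lemma layer_estimate (E F : list C) (p q r k q' Q : R) :
  E <> nil -> F <> nil ->
  (forall z, In z E -> Cmod z = 1) -> (forall z, In z F -> Cmod z = 1) ->
  0 <= p -> 0 <= r -> 0 <= k < 1 -> k * p <= r -> 0 <= q' < 1 -> q' <= q -> q - q' <= Q ->
  exists A B, 2 <= A /\ 0 < B /\ forall (f : C -> C) (K c s : R) (l : list (C * nat)),
    (forall z, Cmod z < 1 -> Cdiff f z) -> Cmod (f 0%C) = 1 -> 0 < K ->
    (forall z, Cmod z < 1 -> f z <> 0%C -> ln (Cmod (f z)) <=
       K / Rpower (1 - Cmod z) p * Rpower (dist_set z E) r / Rpower (dist_set z F) q) ->
    0 < c < 1 -> 0 < s < 1 -> NoDup (map fst l) ->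
    (forall am, In am l -> Cmod (fst am) < 1 /\ factors_at f (fst am) (snd am) /\
       A * c * Rpower (dist_set (fst am) E) k <= 1 - Cmod (fst am) /\
       A * s <= dist_set (fst am) F) ->
    lsum (fun am => INR (snd am) * (1 - Cmod (fst am))) l <=
      B * K * (Rpower c (- p) * Rpower s (- Q)).
Proof.
  intros HE HF HE1 HF1 Hp Hr Hk Hkp Hq' Hqq HQ.
  pose proof (cos_half_pi_pos k Hk) as Hg. pose proof (cos_half_pi_pos q' Hq') as Hg'.
  set (g := cos (k * (PI / 2))) in *. set (g' := cos (q' * (PI / 2))) in *.
  assert (Hn : 1 <= INR (length F)).
  { destruct F; [congruence|]. simpl length. rewrite S_INR. pose proof (pos_INR (length F)). lra. }
  set (n := INR (length F)) in *.
  (* At 0 the thin kernel is at most 1 and each of the n poles equals 1, so the correction there is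
     at most half of 1 - |zeta|. *)
  set (al := / (2 * (1 + n))).
  assert (Hal : 0 < al) by (apply Rinv_0_lt_compat; lra).
  assert (Hal2 : al * (1 + n) = 1 / 2) by (unfold al; field; lra).
  (* One summand for each lower bound on A demanded near E and near F. *)
  set (A := 16 + 32 / (al * g) + 16 / al).
  assert (Halg : 0 < al * g) by (apply Rmult_lt_0_compat; lra).
  assert (A1 : 0 < 32 / (al * g)) by (apply Rdiv_lt_0_compat; lra).
  assert (A2 : 0 < 16 / al) by (apply Rdiv_lt_0_compat; lra).
  assert (HA16 : 16 <= A) by (unfold A; lra).
  assert (HA32 : 32 <= A * (al * g)).
  { replace 32 with (32 / (al * g) * (al * g)) at 1 by (field; lra).
    apply Rmult_le_compat_r; unfold A; lra. }
  assert (HAal : 16 <= al * A).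
  { replace 16 with (al * (16 / al)) at 1 by (field; lra).
    apply Rmult_le_compat_l; unfold A; lra. }
  (* The 2 comes from Jensen's inequality, n from the value of the majorant at 0, 2^r from the
     growth bound and g' from the real part of the power poles. *)
  exists A, (2 * n * Rpower 2 r / g'). pose proof (Rpower_pos 2 r) as P2r.
  split; [lra|]. split; [apply Rdiv_lt_0_compat; nra|].
  intros f K c s l Hf Hf0 HK Hgrow Hc Hs Hnd Hl.
  destruct (exists_lower_bound (fun am => dist_set (fst am) E) l) as [t [Ht Htl]].
  { intros am Ham. destruct (Hl am Ham) as [H1 _].
    pose proof (dist_set_circle E (fst am) HE HE1). lra. }
  set (L := K * Rpower 2 r * (Rpower c (- p) * Rpower s (- Q)) / g').
  assert (HL : 0 < L).
  { unfold L. pose proof (Rpower_pos c (- p)). pose proof (Rpower_pos s (- Q)).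
    apply Rdiv_lt_0_compat; [|lra]. repeat apply Rmult_lt_0_compat; lra. }
  (* The floor [t] keeps [rho >= 0] away from the points of [E], where [f] need not extend. *)
  set (rho := fun z => Rmin (1 - Cmod z - c * Rpower (Rmax (dist_set z E) t) k) (dist_set z F - s)).
  set (H := fun z => (RtoC L * csum (power_pole q') F z)%C).
  assert (HM : forall z, 0 < Rmax (dist_set z E) t).
  { intro z. pose proof (Rmax_r (dist_set z E) t). lra. }
  assert (rho1 : forall z, 0 <= rho z -> c * Rpower (Rmax (dist_set z E) t) k <= 1 - Cmod z /\
    s <= dist_set z F).
  { intros z Hz. unfold rho in Hz.
    pose proof (Rmin_l (1 - Cmod z - c * Rpower (Rmax (dist_set z E) t) k) (dist_set z F - s)).
    pose proof (Rmin_r (1 - Cmod z - c * Rpower (Rmax (dist_set z E) t) k) (dist_set z F - s)).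
    lra. }
  assert (rho2 : forall z, 0 <= rho z -> Cmod z < 1).
  { intros z Hz. destruct (rho1 z Hz) as [H1 _].
    pose proof (Rpower_pos (Rmax (dist_set z E) t) k).
    assert (0 < c * Rpower (Rmax (dist_set z E) t) k) by (apply Rmult_lt_0_compat; lra). lra. }
  assert (J : lsum (fun am => INR (snd am) * (1 - Cmod (fst am))) l <= 2 * Re (H 0%C)).
  { apply (jensen_inequality rho f H (correction k al F) l); auto.
    - intro z. unfold rho. apply Rcont_Rmin.
      + apply (Rcont_minus (fun z => 1 - Cmod z)).
        * apply (Rcont_minus (fun _ => 1)); [apply Rcont_const|apply Rcont_Cmod].
        * apply (Rcont_mult (fun _ => c)); [apply Rcont_const|].
          apply (Rcont_comp (fun z => Rmax (dist_set z E) t) (fun x => Rpower x k)).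
          -- apply Rcont_Rmax_const, Rcont_dist_set, HE.
          -- apply continuity_pt_Rpower, HM.
      + apply Rcont_minus; [apply Rcont_dist_set, HF|apply Rcont_const].
    (* The origin has distance 1 to both sets, and c, s < 1 and t <= 1 place it in the domain. *)
    - unfold rho. pose proof (dist_set_circle E 0%C HE HE1) as D1.
      pose proof (dist_set_circle F 0%C HF HF1) as D2. rewrite Cmod_0 in *.
      apply Rmin_glb; [|lra].
      assert (Rpower (Rmax (dist_set 0 E) t) k <= 1).
      { apply Rpower_le_1; [lra|]. split; [apply HM|]. apply Rmax_lub; lra. }
      assert (c * Rpower (Rmax (dist_set 0 E) t) k <= 1 * 1).
      { apply Rmult_le_compat; try lra. left; apply Rpower_pos. }
      lra.
    - intros z Hz. unfold H. apply Cdiff_mult; [apply Cdiff_const|].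
      apply Cdiff_csum. intros xi Hxi. apply Cdiff_power_pole; auto.
    - intros am Ham. destruct (Hl am Ham) as [H1 [H2 _]]. auto.
    - intros am z Ham Hz. destruct (Hl am Ham) as [H1 _]. unfold correction.
      apply Cdiff_mult; [apply Cdiff_const|]. apply Cdiff_plus.
      + apply Cdiff_thin_kernel; auto.
      + apply Cdiff_csum. intros xi Hxi. apply Cdiff_pole; auto.
    - intros am z Ham Hz. destruct (Hl am Ham) as [H1 [_ [H3 H4]]].
      assert (Hz0 : 0 <= rho z) by lra. pose proof (rho2 z Hz0) as Hz1.
      unfold rho in Hz. unfold Rmin in Hz.
      destruct (Rle_dec (1 - Cmod z - c * Rpower (Rmax (dist_set z E) t) k) (dist_set z F - s)).
      + apply (correction_near_E k al A c t E F); auto; try lra.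
        split; [lra|apply Htl, Ham].
      + apply (correction_near_F k al A s F); auto; lra.
    - intros am Ham. destruct (Hl am Ham) as [H1 _].
      rewrite Re_correction, (Re_csum_eq pole F 0%C 1 Re_pole_0). fold n.
      pose proof (thin_kernel_0 k (fst am)) as HT0.
      replace ((1 - Cmod (fst am)) / 2) with ((1 - Cmod (fst am)) * (al * (1 + n)))
        by (rewrite Hal2; field).
      replace (al * (1 - Cmod (fst am)) * (Re (thin_kernel k (fst am) 0) + n * 1))
        with ((1 - Cmod (fst am)) * (al * (Re (thin_kernel k (fst am) 0) + n))) by ring.
      apply Rmult_le_compat_l; [lra|]. apply Rmult_le_compat_l; lra.
    - intros z Hz Hfz. assert (Hz0 : 0 <= rho z) by lra.
      destruct (rho1 z Hz0) as [R1 R2]. pose proof (rho2 z Hz0) as Hz1.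
      pose proof (dist_set_circle E z HE HE1) as D1.
      eapply Rle_trans; [apply Hgrow; auto|].
      eapply Rle_trans; [apply (growth_bound K p q r k q' Q c s); auto; try lra|].
      + eapply Rle_trans; [|exact R1]. apply Rmult_le_compat_l; [lra|].
        apply Rpower_le_base; [lra|]. split; [lra|apply Rmax_l].
      + unfold H. rewrite Re_scal.
        destruct (dist_set_attained z F HF) as [xi [Hxi Exi]].
        assert (Hnn : forall a, In a F -> 0 <= Re (power_pole q' a z)).
        { intros a Ha. eapply Rle_trans; [|apply Re_power_pole_ge; auto].
          apply Rmult_le_pos; [fold g'; lra|]. left. apply Rinv_0_lt_compat, Rpower_pos. }
        pose proof (Re_csum_ge (power_pole q') F z xi Hnn Hxi) as S1.
        pose proof (Re_power_pole_ge q' xi z Hq' (HF1 xi Hxi) Hz1) as S2.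
        rewrite <- Exi in S2. fold g' in S2.
        apply Rle_trans with (L * (g' * / Rpower (dist_set z F) q')).
        * right. unfold L. field. pose proof (Rpower_pos (dist_set z F) q'). lra.
        * apply Rmult_le_compat_l; lra. }
  eapply Rle_trans; [exact J|]. unfold H.
  rewrite Re_scal, (Re_csum_eq (power_pole q') F 0%C 1 (Re_power_pole_0 q')). fold n.
  right. unfold L. field. lra.
Qed.

(** * Summation over layers *)

Lemma lsum_le (g h : C * nat -> R) (l : list (C * nat)) :
  (forall am, In am l -> g am <= h am) -> lsum g l <= lsum h l.
Proof.
  induction l as [|a l IH]; intro H; simpl; [lra|].
  pose proof (H a (or_introl eq_refl)).
  assert (lsum g l <= lsum h l) by (apply IH; intros am Ham; apply H; right; exact Ham). lra.
Qed.

Lemma lsum_lin (g h : C * nat -> R) (c : R) (l : list (C * nat)) :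
  lsum (fun am => g am + c * h am) l = lsum g l + c * lsum h l.
Proof. induction l as [|a l IH]; simpl; [ring|]. rewrite IH. ring. Qed.

Lemma lsum_filter (g : C * nat -> R) (b : C * nat -> bool) (l : list (C * nat)) :
  lsum g (filter b l) = lsum (fun am => if b am then g am else 0) l.
Proof.
  induction l as [|a l IH]; simpl; [reflexivity|].
  destruct (b a); simpl; rewrite IH; [reflexivity|ring].
Qed.

Lemma NoDup_map_filter (b : C * nat -> bool) (l : list (C * nat)) :
  NoDup (map fst l) -> NoDup (map fst (filter b l)).
Proof.
  induction l as [|a l IH]; simpl; intro H; [exact H|].
  apply NoDup_cons_iff in H as [H1 H2].
  destruct (b a); simpl; [|auto]. apply NoDup_cons; [|auto].
  intro Hin. apply H1. apply in_map_iff in Hin as [x [E Hx]].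
  apply filter_In in Hx as [Hx _]. rewrite <- E. apply in_map. exact Hx.
Qed.

(** The factor 2^p is the ratio of neighbouring levels to the power p, the 1 accounts for the top
    level, and the reciprocal is a geometric series of ratio 2^(-e). *)
Definition dyadic_const (p e : R) : R := Rpower 2 p * (1 + / (1 - Rpower 2 (- e))).

Lemma Rpower_2_neg_lt_1 (e : R) : 0 < e -> Rpower 2 (- e) < 1.
Proof. intro He. rewrite <- (Rpower_O 2) by lra. apply Rpower_lt; lra. Qed.

Lemma dyadic_const_pos (p e : R) : 0 < e -> 0 < dyadic_const p e.
Proof.
  intro He. pose proof (Rpower_2_neg_lt_1 e He). unfold dyadic_const.
  apply Rmult_lt_0_compat; [apply Rpower_pos|].
  pose proof (Rinv_0_lt_compat (1 - Rpower 2 (- e)) ltac:(lra)). lra.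
Qed.

(** Where 2^(-J-1) <= u < 2^(-J), the power of u is at most 2^(-J (p+e)), while the level sum is at
    most B 2^((J+1) p). The product B 2^p 2^(-e J) is summable in J. *)
Lemma dyadic_sum (a u : C * nat -> R) (l : list (C * nat)) (B p e : R) :
  0 <= p -> 0 < e -> 0 <= B ->
  (forall am, In am l -> 0 <= a am /\ 0 < u am <= 1) ->
  (forall c, 0 < c <= 1 ->
     lsum (fun am => if Rle_dec c (u am) then a am else 0) l <= B * Rpower c (- p)) ->
  lsum (fun am => a am * Rpower (u am) (p + e)) l <= dyadic_const p e * B.
Proof.
  intros Hp He HB Hau Hlev.
  set (c := fun J : nat => Rpower 2 (- INR J)).
  assert (Hc : forall J, 0 < c J <= 1).
  { intro J. split; [apply Rpower_pos|]. unfold c. pose proof (pos_INR J).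
    rewrite <- (Rpower_O 2) by lra. apply Rle_Rpower; lra. }
  pose proof (Rpower_2_neg_lt_1 e He) as Hr. pose proof (Rpower_pos 2 (- e)) as Hr0.
  set (rho := Rpower 2 (- e)) in *.
  pose proof (Rpower_pos 2 p) as H2p.
  set (T := fun J => lsum (fun am => if Rle_dec (c J) (u am) then a am * Rpower (u am) (p + e) else 0) l).
  assert (HT : forall J, T J <= B * Rpower 2 p * (1 + (1 - rho ^ J) / (1 - rho))).
  { induction J as [|J IH].
    - apply Rle_trans with (B * Rpower 1 (- p)).
      + eapply Rle_trans; [|apply (Hlev 1); lra]. apply lsum_le. intros am Ham.
        destruct (Hau am Ham) as [Ha Hu].
        assert (E : c 0%nat = 1) by (unfold c; simpl; rewrite Ropp_0; apply Rpower_O; lra).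
        rewrite E. destruct (Rle_dec 1 (u am)); [|lra].
        pose proof (Rpower_le_1 (u am) (p + e) ltac:(lra) ltac:(lra)). nra.
      + simpl. replace ((1 - 1) / (1 - rho)) with 0 by (field; lra).
        replace (Rpower 1 (- p)) with 1 by (unfold Rpower; rewrite ln_1, Rmult_0_r, exp_0; reflexivity).
        pose proof (Rpower_1_le 2 p Hp ltac:(lra)). nra.
    - apply Rle_trans with (T J + Rpower (c J) (p + e) *
        lsum (fun am => if Rle_dec (c (S J)) (u am) then a am else 0) l).
      + unfold T. rewrite <- lsum_lin. apply lsum_le. intros am Ham.
        destruct (Hau am Ham) as [Ha Hu].
        pose proof (Rpower_pos (c J) (p + e)).
        destruct (Rle_dec (c (S J)) (u am)) as [D1|D1]; destruct (Rle_dec (c J) (u am)) as [D2|D2].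
        * assert (0 <= Rpower (c J) (p + e) * a am) by (apply Rmult_le_pos; lra). lra.
        * rewrite Rplus_0_l, (Rmult_comm _ (a am)). apply Rmult_le_compat_l; [exact Ha|].
          apply Rpower_le_base; lra.
        * assert (0 <= a am * Rpower (u am) (p + e))
            by (apply Rmult_le_pos; [exact Ha|left; apply Rpower_pos]). lra.
        * lra.
      + assert (E : Rpower (c J) (p + e) * (B * Rpower (c (S J)) (- p)) = B * Rpower 2 p * rho ^ J).
        { assert (Er : rho ^ J = Rpower 2 (- e * INR J)).
          { unfold rho. rewrite <- Rpower_pow by apply Rpower_pos. apply Rpower_mult. }
          rewrite Er. unfold c. rewrite !Rpower_mult, S_INR.
          replace (Rpower 2 (- INR J * (p + e)) * (B * Rpower 2 (- (INR J + 1) * - p)))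
            with (B * (Rpower 2 (- INR J * (p + e)) * Rpower 2 (- (INR J + 1) * - p))) by ring.
          rewrite <- Rpower_plus, Rmult_assoc, <- Rpower_plus. do 2 f_equal. ring. }
        specialize (Hlev (c (S J)) (Hc (S J))).
        apply (Rmult_le_compat_l (Rpower (c J) (p + e))) in Hlev; [|left; apply Rpower_pos].
        rewrite E in Hlev.
        replace (B * Rpower 2 p * (1 + (1 - rho ^ S J) / (1 - rho))) with
          (B * Rpower 2 p * (1 + (1 - rho ^ J) / (1 - rho)) + B * Rpower 2 p * rho ^ J)
          by (simpl; field; lra).
        lra. }
  (* The list being finite, some level lies below all values of u, and the truncated sum there is
     the full one. *)
  destruct (exists_lower_bound u l) as [t [Ht Htl]]; [intros am Ham; apply Hau, Ham|].
  destruct (INR_unbounded (- ln t / ln 2)) as [J HJ].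
  assert (Hln2 : 0 < ln 2) by (rewrite <- ln_1; apply ln_increasing; lra).
  assert (HcJ : c J <= t).
  { unfold c, Rpower. rewrite <- (exp_ln t) by lra. left. apply exp_increasing.
    apply Rlt_div_l in HJ; lra. }
  apply Rle_trans with (T J).
  - apply lsum_le. intros am Ham. destruct (Rle_dec (c J) (u am)) as [_|D]; [lra|].
    specialize (Htl am Ham). lra.
  - eapply Rle_trans; [apply HT|]. unfold dyadic_const. fold rho.
    replace (Rpower 2 p * (1 + / (1 - rho)) * B) with (B * Rpower 2 p * (1 + / (1 - rho))) by ring.
    apply Rmult_le_compat_l; [apply Rmult_le_pos; lra|].
    assert (0 <= rho ^ J) by (apply pow_le; lra).
    assert ((1 - rho ^ J) / (1 - rho) <= 1 * / (1 - rho)).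
    { apply Rmult_le_compat_r; [left; apply Rinv_0_lt_compat; lra|lra]. }
    lra.
Qed.

(** Of u^(p + eps) the part u^(eps/2) is exchanged for dF^e' by u <= dF^(1-k), which leaves a
    surplus in the exponents of both u and dF. The factor 2^(Q + e') pays for replacing dF by
    dF/2. *)
Lemma weight_bound (d eE dF p eps b Q : R) :
  0 <= p -> 0 < eps -> 0 <= b <= p -> 0 < d <= 1 -> d <= eE -> d <= dF ->
  let k := b / (p + eps) in let e' := (1 - k) * (eps / 2) in
  Rpower d (p + 1 + eps) * Rpower dF Q / Rpower eE b <=
  Rpower 2 (Q + e') *
    (d * Rpower (d * Rpower eE (- k)) (p + eps / 2) * Rpower (dF / 2) (Q + e')).
Proof.
  intros Hp He Hb Hd HdE HdF k e'.
  assert (Hk : 0 <= k < 1).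
  { unfold k. split; [apply Rdiv_le_0_compat; lra|]. apply Rlt_div_l; lra. }
  pose proof (Rpower_pos eE (- k)) as P1.
  set (u := d * Rpower eE (- k)).
  assert (Hu : 0 < u) by (apply Rmult_lt_0_compat; lra).
  assert (E1 : Rpower u (p + eps) = Rpower d (p + eps) / Rpower eE b).
  { unfold u. rewrite <- Rpower_mult_distr, Rpower_mult by lra. unfold Rdiv.
    rewrite <- (Rpower_Ropp eE b). do 2 f_equal. unfold k. field. lra. }
  assert (E2 : Rpower u (eps / 2) <= Rpower dF e').
  { assert (Hu1 : u <= Rpower dF (1 - k)).
    { apply Rle_trans with (Rpower d (1 - k)); [|apply Rpower_le_base; lra].
      unfold Rminus. rewrite Rpower_plus, Rpower_1 by lra. unfold u.
      apply Rmult_le_compat_l; [lra|]. rewrite !Rpower_Ropp.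
      apply Rinv_le_contravar; [apply Rpower_pos|apply Rpower_le_base; lra]. }
    unfold e'. rewrite <- Rpower_mult. apply Rpower_le_base; lra. }
  assert (E3 : Rpower 2 (Q + e') * Rpower (dF / 2) (Q + e') = Rpower dF Q * Rpower dF e').
  { rewrite Rpower_mult_distr, <- Rpower_plus by lra. f_equal. field. }
  replace (Rpower 2 (Q + e') * (d * Rpower u (p + eps / 2) * Rpower (dF / 2) (Q + e')))
    with (d * Rpower u (p + eps / 2) * (Rpower 2 (Q + e') * Rpower (dF / 2) (Q + e'))) by ring.
  rewrite E3.
  replace (p + 1 + eps) with (1 + (p + eps)) by ring. rewrite Rpower_plus, Rpower_1 by lra.
  replace (d * Rpower d (p + eps) * Rpower dF Q / Rpower eE b)
    with (d * (Rpower d (p + eps) / Rpower eE b) * Rpower dF Q) by (unfold Rdiv; ring).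
  rewrite <- E1. replace (p + eps) with ((p + eps / 2) + eps / 2) by field.
  rewrite Rpower_plus.
  replace (d * (Rpower u (p + eps / 2) * Rpower u (eps / 2)) * Rpower dF Q)
    with (d * Rpower u (p + eps / 2) * (Rpower dF Q * Rpower u (eps / 2))) by ring.
  apply Rmult_le_compat_l.
  - apply Rmult_le_pos; [lra|left; apply Rpower_pos].
  - apply Rmult_le_compat_l; [left; apply Rpower_pos|exact E2].
Qed.

(** * The two dyadic summations combined *)

Theorem theorem0p1 :
  forall (E F : list C) (p q r eps : R),
    E <> nil -> F <> nil ->
    NoDup E -> NoDup F ->
    (forall z, In z E -> Cmod z = 1) ->
    (forall z, In z F -> Cmod z = 1) ->
    (forall z, In z E -> ~ In z F) ->
    0 <= p -> 0 <= q -> 0 <= r -> 0 < eps ->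
    exists C2 : R, 0 < C2 /\
      forall (f : C -> C) (K : R),
        analytic_on_disk f ->
        Cmod (f 0%C) = 1 ->
        0 < K ->
        (forall z, in_disk z -> f z <> 0%C ->
           ln (Cmod (f z)) <=
             K / rpow (1 - Cmod z) p
               * rpow (dist_set z E) r / rpow (dist_set z F) q) ->
        zero_sum_le f (zero_weight E F p q r eps) (C2 * K).
Proof.
  intros E F p q r eps HE HF _ _ HE1 HF1 _ Hp Hq Hr He.
  set (b := Rmin p r). set (k := b / (p + eps)).
  (* The largest admissible exponent not above 1 - eps is kept in the majorant. For eps >= 1 it is
     0, and then q <= q - 1 + eps, so q - q' <= Q in every case. *)
  set (q' := Rmin q (Rmax 0 (1 - eps))). set (Q := pos_part (q - 1 + eps)).
  assert (Hb : 0 <= b <= p /\ b <= r).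
  { unfold b. pose proof (Rmin_l p r). pose proof (Rmin_r p r).
    pose proof (Rmin_glb p r 0 Hp Hr). lra. }
  assert (Hk : 0 <= k < 1).
  { unfold k. split; [apply Rdiv_le_0_compat; lra|]. apply Rlt_div_l; lra. }
  assert (Hkp : k * p <= r).
  { apply Rle_trans with (k * (p + eps)); [apply Rmult_le_compat_l; lra|].
    unfold k. replace (b / (p + eps) * (p + eps)) with b by (field; lra). lra. }
  assert (HQ : 0 <= Q) by apply Rmax_r.
  assert (HQ1 : q - 1 + eps <= Q) by apply Rmax_l.
  assert (Hq' : 0 <= q' < 1 /\ q' <= q /\ q - q' <= Q).
  { unfold q', Rmin, Rmax. destruct (Rle_dec 0 (1 - eps)); destruct (Rle_dec q _); lra. }
  set (e := eps / 2). set (e' := (1 - k) * e).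
  assert (He2 : 0 < e) by (unfold e; lra).
  assert (He' : 0 < e') by (apply Rmult_lt_0_compat; lra).
  destruct (layer_estimate E F p q r k q' Q HE HF HE1 HF1 Hp Hr Hk Hkp
    (proj1 Hq') (proj1 (proj2 Hq')) (proj2 (proj2 Hq'))) as [A [B [HA [HB Hlayer]]]].
  set (D := dyadic_const Q e' * (dyadic_const p e * (B * Rpower A p * Rpower A Q))).
  assert (HD : 0 < D).
  { unfold D. pose proof (dyadic_const_pos Q e' He'). pose proof (dyadic_const_pos p e He2).
    pose proof (Rpower_pos A p). pose proof (Rpower_pos A Q).
    assert (0 < B * Rpower A p * Rpower A Q) by (repeat apply Rmult_lt_0_compat; assumption).
    apply Rmult_lt_0_compat; [assumption|]. apply Rmult_lt_0_compat; assumption. }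
  exists (Rpower 2 (Q + e') * D). pose proof (Rpower_pos 2 (Q + e')) as P2.
  split; [apply Rmult_lt_0_compat; assumption|].
  intros f K Hf Hf0 HK Hgrow l Hnd Hl.
  set (a := fun am : C * nat => INR (snd am) * (1 - Cmod (fst am))).
  set (u := fun am : C * nat => (1 - Cmod (fst am)) * Rpower (dist_set (fst am) E) (- k)).
  (* Distances to F can approach 2; halving makes [dyadic_sum] applicable. *)
  set (v := fun am : C * nat => dist_set (fst am) F / 2).
  assert (Hgeo : forall am, In am l -> 0 < 1 - Cmod (fst am) <= 1 /\
    1 - Cmod (fst am) <= dist_set (fst am) E /\ 1 - Cmod (fst am) <= dist_set (fst am) F <= 2).
  { intros am Ham. destruct (Hl am Ham) as [H1 _]. unfold in_disk in H1.
    pose proof (Cmod_ge_0 (fst am)). pose proof (dist_set_circle E (fst am) HE HE1).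
    pose proof (dist_set_circle F (fst am) HF HF1). lra. }
  assert (Hu : forall am, In am l -> 0 < u am <= 1).
  { intros am Ham. destruct (Hgeo am Ham) as [G1 [G2 _]]. unfold u. split.
    - apply Rmult_lt_0_compat; [lra|apply Rpower_pos].
    - rewrite Rpower_Ropp. pose proof (Rpower_pos (dist_set (fst am) E) k).
      apply Rle_div_l; [lra|]. rewrite Rmult_1_l.
      apply Rle_trans with (Rpower (1 - Cmod (fst am)) k); [|apply Rpower_le_base; lra].
      rewrite <- (Rpower_1 (1 - Cmod (fst am))) at 1 by lra.
      apply Rpower_anti_exponent; lra. }
  assert (Ha : forall am, In am l -> 0 <= a am).
  { intros am Ham. destruct (Hgeo am Ham) as [G1 _].
    apply Rmult_le_pos; [apply pos_INR|lra]. }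
  assert (Hlev : forall c s, 0 < c <= 1 -> 0 < s <= 1 ->
    lsum (fun am => if Rle_dec c (u am) then (if Rle_dec s (v am) then a am else 0) else 0) l <=
    B * Rpower A p * Rpower A Q * K * Rpower s (- Q) * Rpower c (- p)).
  { intros c s Hc Hs.
    set (sel := fun am => if Rle_dec c (u am) then (if Rle_dec s (v am) then true else false) else false).
    assert (Es : lsum a (filter sel l) =
      lsum (fun am => if Rle_dec c (u am) then (if Rle_dec s (v am) then a am else 0) else 0) l).
    { rewrite lsum_filter. apply Rle_antisym; apply lsum_le; intros am _; unfold sel;
      destruct (Rle_dec c (u am)), (Rle_dec s (v am)); lra. }
    (* The layer at levels c/A and s/A consists of zeros with u >= c and v >= s, as A cancels. Since
       A >= 2, even the level 1 becomes strictly less than 1; the price is the factor A^p A^Q. *)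
    assert (Hdiv : forall x, 0 < x <= 1 -> 0 < x / A < 1).
    { intros x Hx. split; [apply Rdiv_lt_0_compat; lra|]. apply Rlt_div_l; lra. }
    assert (Epow : forall x y, 0 < x -> Rpower (x / A) (- y) = Rpower x (- y) * Rpower A y).
    { intros x y Hx. unfold Rdiv. rewrite <- Rpower_mult_distr by (try apply Rinv_0_lt_compat; lra).
      f_equal. rewrite <- (Rpower_1 A) at 1 by lra. rewrite <- Rpower_Ropp, Rpower_mult.
      f_equal. ring. }
    rewrite <- Es.
    eapply Rle_trans; [apply (Hlayer f K (c / A) (s / A) (filter sel l)); auto|].
    - intros z Hz. apply C_differentiable_Cdiff, Hf, Hz.
    - apply NoDup_map_filter, Hnd.
    - intros am Ham. apply filter_In in Ham as [Ham Hsel].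
      destruct (Hl am Ham) as [H1 [_ H3]]. destruct (Hgeo am Ham) as [G1 [G2 G3]].
      unfold sel in Hsel. destruct (Rle_dec c (u am)) as [L1|]; [|discriminate].
      destruct (Rle_dec s (v am)) as [L2|]; [|discriminate].
      split; [exact H1|split; [apply zero_mult_factors_at, H3|split]].
      + replace (A * (c / A)) with c by (field; lra). unfold u in L1.
        rewrite Rpower_Ropp in L1. pose proof (Rpower_pos (dist_set (fst am) E) k).
        apply Rle_div_r in L1; lra.
      + replace (A * (s / A)) with s by (field; lra). unfold v in L2. lra.
    - rewrite !Epow by lra. right. ring. }
  (* Summation over c with s fixed; its result is again a level bound, now in s, to which
     [dyadic_sum] applies once more. *)
  assert (Hfirst : forall s, 0 < s <= 1 ->
    lsum (fun am => if Rle_dec s (v am) then a am * Rpower (u am) (p + e) else 0) l <=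
    dyadic_const p e * (B * Rpower A p * Rpower A Q) * K * Rpower s (- Q)).
  { intros s Hs.
    apply Rle_trans with
      (dyadic_const p e * (B * Rpower A p * Rpower A Q * K * Rpower s (- Q))); [|right; ring].
    eapply Rle_trans; [|apply (dyadic_sum (fun am => if Rle_dec s (v am) then a am else 0) u l)].
    - apply lsum_le. intros am _. destruct (Rle_dec s (v am)); [lra|].
      rewrite Rmult_0_l. lra.
    - exact Hp.
    - exact He2.
    - pose proof (Rpower_pos A p). pose proof (Rpower_pos A Q). pose proof (Rpower_pos s (- Q)).
      repeat apply Rmult_le_pos; lra.
    - intros am Ham. split; [|auto]. destruct (Rle_dec s (v am)); [auto|lra].
    - intros c Hc. apply Hlev; assumption. }
  assert (Hsecond : lsum (fun am => a am * Rpower (u am) (p + e) * Rpower (v am) (Q + e')) l <= D * K).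
  { apply Rle_trans with (dyadic_const Q e' * (dyadic_const p e * (B * Rpower A p * Rpower A Q) * K));
      [|right; unfold D; ring].
    apply (dyadic_sum (fun am => a am * Rpower (u am) (p + e)) v l); auto.
    - pose proof (dyadic_const_pos p e He2). pose proof (Rpower_pos A p). pose proof (Rpower_pos A Q).
      assert (0 < B * Rpower A p * Rpower A Q) by (repeat apply Rmult_lt_0_compat; assumption).
      apply Rmult_le_pos; [|lra]. apply Rmult_le_pos; lra.
    - intros am Ham. destruct (Hgeo am Ham) as [G1 [G2 G3]]. split.
      + apply Rmult_le_pos; [auto|left; apply Rpower_pos].
      + unfold v. lra. }
  change (lsum (fun am => INR (snd am) * zero_weight E F p q r eps (fst am)) l
    <= Rpower 2 (Q + e') * D * K).
  apply Rle_trans with (lsum (fun am => 0 + Rpower 2 (Q + e') *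
    (a am * Rpower (u am) (p + e) * Rpower (v am) (Q + e'))) l).
  - apply lsum_le. intros am Ham. destruct (Hgeo am Ham) as [G1 [G2 G3]].
    pose proof (weight_bound (1 - Cmod (fst am)) (dist_set (fst am) E) (dist_set (fst am) F)
      p eps b Q Hp He (proj1 Hb) G1 G2 (proj1 G3)) as W. cbv zeta in W.
    fold k e e' in W. apply (Rmult_le_compat_l (INR (snd am))) in W; [|apply pos_INR].
    unfold zero_weight, rpow. fold Q b. unfold a, u, v. lra.
  - rewrite lsum_lin.
    assert (Z : lsum (fun _ => 0) l = 0) by (clear; induction l as [|x l IH]; simpl; [|rewrite IH]; ring).
    rewrite Z, Rplus_0_l, Rmult_assoc. apply Rmult_le_compat_l; lra.
Qed.
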